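(* (1) The map $\widetilde T_{PL}:G[[r]]\times\widehat{\mathcal{C}}_{PL}\to PL$ defined by $\widetilde T_{PL}(s,g)=T_{PL}(s)\cdot g$ is a homeomorphism. (2) $\widehat{\mathcal{C}}_{PL}$ is generated by the elements $e^a\cdot e^b\cdot e^{-s(a,b)}$ for all possible $a,b\in L$. (3) $\widehat{\mathcal{C}}_{PL}$ is a dense subgroup of $\widehat{\mathcal{C}}_f$.
   Context: Algebra. Let $\mathbb{C}\langle X_1,X_2,\dots\rangle$ be the associative algebra with unit $I$ of complex noncommutative polynomials in free noncommuting variables $X_1,X_2,\dots$. Let $\mathcal{A}\subset\mathbb{C}\langle X_1,X_2,\dots\rangle[[t]]$ be the subalgebra of formal power series of the form $f=c_0I+\sum_{n\ge1}\big(\sum_{i_1+\cdots+i_k=n}c_{i_1,\dots,i_k}X_{i_1}\cdots X_{i_k}\big)t^n$ with complex coefficients (inner sum over all $k\ge1$ and all $(i_1,\dots,i_k)\in\mathbb{N}^k$ with sum $n$). Equip $\mathcal{A}$ with the weakest topology making all coefficient functions continuous. Let $G\subset\mathcal{A}$ be the topological group (under multiplication) of elements with $c_0=1$, and $\mathcal{L}_G$ the Lie algebra of elements with $c_0=0$, with $[f,g]=fg-gf$; $\exp:\mathcal{L}_G\to G$ is a homeomorphism with inverse $\log$. $\mathcal{L}_{Lie}\subset\mathcal{L}_G$ is the Lie subalgebra of Lie elements, i.e. of $g=\sum_{n\ge1}g_nt^n$ with each $g_n$ in the free Lie algebra generated by $X_1,\dots,X_n$. $L\subset\mathcal{L}_{Lie}$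 is the subspace of elements $\sum_{n\ge1}c_nX_nt^n$, $c_n\in\mathbb{C}$. Paths. Fix $T>0$, $I_T=[0,T]$. $X$ is the set of sequences $a=(a_1,a_2,\dots)$ of complex-valued functions $a_i\in L^\infty(I_T)$ with $\sup_{x\in I_T,\,i\in\mathbb{N}}|a_i(x)|^{1/i}<\infty$. For $a\in X$ let $F_a:I_T\to G$ be the solution of $F'(x)=\big(\sum_{i\ge1}a_i(x)t^iX_i\big)F(x)$, $F_a(0)=I$, and $E(a)=F_a(T)\in G$. $G(X):=E(X)$ is a subgroup of $G$ and $G_f(X)$, the group of formal paths, is its closure in $G$; one has $G_f(X)=\exp(\mathcal{L}_{Lie})$. (The paper defines these as a quotient of $X$ and its completion and identifies them with these subgroups.) Operators. On $\mathbb{C}[[z]]$ let $D$ be differentiation and $L$ the left translation $\sum_{k\ge0}c_kz^k\mapsto\sum_{k\ge0}c_{k+1}z^k$ (only in expressions $DL^{n-1}$ does $L$ denote this operator). Let $\mathcal{A}(D,L)$ be the unital algebra of operators generated by $D$ and $L$. Each element is uniquely $a_0I+\sum_{k=1}^n\sum_{i=0}^ka_{i,k}D^iL^{k-i}$; $P_n$ denotes the finite-dimensional space of such elements (degree $\le n$). $\mathcal{A}_*$ is the algebra of series $\sum_{n\ge0}f_nt^n$ with $f_n\in P_n$, with the topology of coefficientwise convergence. $\Psi:\mathcal{A}\to\mathcal{A}_*$ is the continuous algebra homomorphism with $\Psi(X_it^i)=DL^{i-1}t^i$. $\mathcal{L}_S:=\Psi(\mathcal{L}_{Lie})=\{\sum_{n\ge1}g_nDL^{n-1}t^n: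 g_n\in\mathbb{C}\}$ and $S:=\Psi(G_f(X))=\exp(\mathcal{L}_S)$; $\log$ also denotes the inverse of the homeomorphism $\exp:\mathcal{L}_S\to S$. $A:\mathcal{L}_S\to L$ is the linear isomorphism with $A\big(\sum g_nDL^{n-1}t^n\big)=\sum g_nX_nt^n$. For $a,b\in L$ put $s(a,b):=A(\Psi(\log(e^a\cdot e^b)))\in L$. First return map. For $a\in X$ let $I_{i_1,\dots,i_k}(a)=\int\cdots\int_{0\le s_1\le\cdots\le s_k\le T}a_{i_k}(s_k)\cdots a_{i_1}(s_1)\,ds_k\cdots ds_1$, and let $\widehat I_{i_1,\dots,i_k}$ be the unique continuous function on $G_f(X)$ with $\widehat I_{i_1,\dots,i_k}(E(a))=I_{i_1,\dots,i_k}(a)$. Let $p_{i_1,\dots,i_k}(t)=(t-i_1+1)(t-i_1-i_2+1)\cdots(t-i_1-\cdots-i_k+1)$. $G[[r]]$ is the topological group of formal complex power series $r+\sum_{i\ge1}d_ir^{i+1}$ under composition, with the weakest topology making all $d_i$ continuous. $\widehat P:G_f(X)\to G[[r]]$, $\widehat P(g)=r+\sum_{i\ge1}\big(\sum_{i_1+\cdots+i_k=i}p_{i_1,\dots,i_k}(i)\widehat I_{i_1,\dots,i_k}(g)\big)r^{i+1}$, is a continuous homomorphism, and there is an isomorphism of topological groups $\Phi:S\to G[[r]]$ with $\widehat P=\Phi\circ\Psi|_{G_f(X)}$. $\widehat{\mathcal{C}}_f:=\ker\widehat P$ is the group of formal centers. Piecewise linear paths. $PL\subset G_f(X)$ is the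 subgroup generated by all $e^h$, $h\in L$, with the induced topology. $\widehat{\mathcal{C}}_{PL}:=\widehat{\mathcal{C}}_f\cap PL$. $T_{PL}:=\exp\circ A\circ\log\circ\Phi^{-1}:G[[r]]\to PL$. *)

(* Defs.v *)
From HB Require Import structures.
From mathcomp Require Import all_boot all_order all_algebra complex.
From mathcomp Require Import all_classical all_reals all_analysis.

Set Implicit Arguments.
Unset Strict Implicit.
Unset Printing Implicit Defensive.

Import Order.TTheory GRing.Theory Num.Theory.
Import numFieldNormedType.Exports.

Local Open Scope classical_set_scope.
Local Open Scope ring_scope.

Definition homeo_on {U V : topologicalType} (A : set U) (B : set V)
    (f : U -> V) : Prop :=
  [/\ set_bij A B f,
      {within A, continuous f} &
      exists2 g : V -> U, {within B, continuous g} & {in A, cancel f g}].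

Section FormalPaths.
Variable R : realType.

(* The complex numbers; going through numClosedFieldType lets the norm topology
   be inferred. *)
Definition cplx : numClosedFieldType := R[i]%C.

(* The letter j : nat stands for X_{j+1}, so a word [:: j1; ...; jk] stands for
   X_{j1+1} ... X_{jk+1}, and the power of t attached to it is its weight. *)
Definition word := seq nat.
Definition weight (w : word) : nat := (\sum_(j <- w) j.+1)%N.

(* In an element of the algebra A the power of t is determined by the word, so
   the element is the family of its coefficients c_w, without restriction.
   The topology is that of pointwise convergence of the coefficients. *)
Definition ncseries := {ptws word -> cplx}.

Definition mulNC (f g : ncseries) : ncseries :=
  fun w => \sum_(k < (size w).+1) f (take k w) * g (drop k w).
Definition oneA : ncseries := fun w => (w == [::])%:R.
Definition expnA (f : ncseries) (k : nat) : ncseries := iter k (mulNC f) oneA.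
(* X_{j+1} t^{j+1} *)
Definition genA (j : nat) : ncseries := fun w => (w == [:: j])%:R.
Definition bracketA (f g : ncseries) : ncseries := mulNC f g - mulNC g f.

Definition groupG : set ncseries := [set f | f [::] = 1].
Definition lieG : set ncseries := [set f | f [::] = 0].

(* If f has no constant term then f^k vanishes on the words of length < k, so
   that truncating the exponential series at the length of w loses nothing. *)
Definition expA (f : ncseries) : ncseries :=
  fun w => \sum_(k < (size w).+1) (k`!%:R)^-1 * expnA f k w.
Definition logA : ncseries -> ncseries := 'pinv_(fun=> 0) lieG expA.

(* The Lie algebra generated by X_1, ..., X_n inside the free associative
   algebra, the latter being seen inside ncseries. *)
Inductive free_lie (n : nat) : ncseries -> Prop :=
| free_lie_gen j : (j < n)%N -> free_lie n (genA j)
| free_lie0 : free_lie n 0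
| free_lieD f g : free_lie n f -> free_lie n g -> free_lie n (f + g)
| free_lieZ (c : cplx) f : free_lie n f -> free_lie n (c *: f)
| free_lieB f g : free_lie n f -> free_lie n g -> free_lie n (bracketA f g).

(* g_n t^n, for g = \sum_n g_n t^n *)
Definition homogA (n : nat) (g : ncseries) : ncseries :=
  fun w => if weight w == n then g w else 0.

Definition lieLie : set ncseries :=
  [set g | lieG g /\ forall n, (0 < n)%N -> free_lie n (homogA n g)].

(* \sum_(n >= 1) c_n X_n t^n, with c_n given by c n.-1 *)
Definition linA (c : nat -> cplx) : ncseries :=
  fun w => if w is [:: j] then c j else 0.
Definition linL : set ncseries := range linA.

Definition is_subgroup (H : set ncseries) : Prop :=
  [/\ H `<=` groupG,
      H oneA,
      forall f g, H f -> H g -> H (mulNC f g) &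
      forall f g, H f -> mulNC f g = oneA -> mulNC g f = oneA -> H g].
Definition gen_subgroup (B : set ncseries) : set ncseries :=
  smallest is_subgroup B.

Definition cintegral (f : R -> cplx) (x : R) : cplx :=
  ((\int[lebesgue_measure]_(s in `[0, x]) complex.Re (f s)) +i*
   (\int[lebesgue_measure]_(s in `[0, x]) complex.Im (f s)))%C.

(* a j is a_{j+1}; it is bounded because of the last condition. Every class in L^oo has a Borel representative, so
   Borel measurability is no restriction. *)
Definition pathX (T : R) : set (nat -> R -> cplx) :=
  [set a : nat -> R -> cplx |
           (forall j, measurable_fun `[0, T] (fun x => complex.Re (a j x)) /\
                      measurable_fun `[0, T] (fun x => complex.Im (a j x))) /\
           exists M : R, forall (j : nat) (x : R), x \in `[0, T] ->
             ComplexField.Normc.normc (a j x) `^ (j.+1%:R^-1) <= M].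

(* F' = (\sum_i a_i t^i X_i) F with F(0) = I, in the sense of Caratheodory
   (the a_i are merely bounded and measurable). *)
Definition is_solution (T : R) (a : nat -> R -> cplx) (F : R -> ncseries) :=
  forall x, x \in `[0, T] -> forall w : word,
    F x w = oneA w + cintegral (fun s => mulNC (linA (a^~ s)) (F s) w) x.

Definition pathE (T : R) (a : nat -> R -> cplx) : ncseries :=
  get (is_solution T a) T.

(* G_f(X), the closure of G(X) = E(X) in G *)
Definition formal_paths (T : R) : set ncseries :=
  closure (pathE T @` pathX T) `&` groupG.

(* Coefficient sequences of commutative power series *)
Definition fpseries := {ptws nat -> cplx}.

Definition opD (u : fpseries) : fpseries := fun k => k.+1%:R * u k.+1.
Definition opL (u : fpseries) : fpseries := fun k => u k.+1.

(* The topology of pointwise convergence on operators induces on each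
   finite-dimensional space P_n its unique Hausdorff vector space topology. *)
Definition oper := {ptws fpseries -> fpseries}.

Definition operP (n : nat) : set oper :=
  [set f | exists (a0 : cplx) (a : nat -> nat -> cplx), forall u : fpseries,
     f u = a0 *: u + \sum_(1 <= k < n.+1) \sum_(i < k.+1)
                       a i k *: iter i opD (iter (k - i) opL u)].

(* \sum_n f_n t^n, as the sequence of the f_n; the algebra A_* is the subset
   algS of those with f_n in P_n. *)
Definition opseries := {ptws nat -> oper}.
Definition algS : set opseries := [set f | forall n, operP n (f n)].

Definition mulS (f g : opseries) : opseries :=
  fun n u => \sum_(k < n.+1) f k (g (n - k)%N u).
Definition oneS : opseries := fun n u => if n == 0%N then u else 0.
Definition expnS (f : opseries) (k : nat) : opseries := iter k (mulS f) oneS.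
(* As for expA: if f_0 = 0 then f^k starts at t^k. *)
Definition expS (f : opseries) : opseries :=
  fun n u => \sum_(k < n.+1) (k`!%:R : cplx)^-1 *: expnS f k n u.

(* \sum_(n >= 1) c_n D L^(n-1) t^n, with c_n given by c n.-1 *)
Definition linS (c : nat -> cplx) : opseries :=
  fun n u => if n is m.+1 then c m *: opD (iter m opL u) else 0.
(* D L^j t^(j+1) *)
Definition genS (j : nat) : opseries := linS (fun i => (i == j)%:R).

(* psi is the continuous homomorphism of unital algebras from A to A_* with
   psi (X_i t^i) = D L^(i-1) t^i. *)
Definition is_Psi (psi : ncseries -> opseries) : Prop :=
  [/\ (forall f, algS (psi f)) /\ continuous psi,
      forall (c : cplx) f g, psi (c *: f + g) = c *: psi f + psi g,
      forall f g, psi (mulNC f g) = mulS (psi f) (psi g),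
      psi oneA = oneS &
      forall j, psi (genA j) = genS j].
Definition Psi : ncseries -> opseries := get is_Psi.

Definition lieS : set opseries := Psi @` lieLie.
Definition groupS (T : R) : set opseries := Psi @` formal_paths T.
Definition logS : opseries -> opseries := 'pinv_(fun=> 0) lieS expS.

(* A (\sum_n g_n D L^(n-1) t^n) = \sum_n g_n X_n t^n *)
Definition mapA (f : opseries) : ncseries :=
  linA (get [set c : nat -> cplx | f = linS c]).

Definition sL (a b : ncseries) : ncseries :=
  mapA (Psi (logA (mulNC (expA a) (expA b)))).

(* G[[r]], with u n the coefficient of r^n, so that d_i = u i.+1 *)
Definition groupGr : set fpseries := [set u | u 0%N = 0 /\ u 1%N = 1].
Definition idGr : fpseries := fun n => (n == 1%N)%:R.
Definition mulP (u v : fpseries) : fpseries :=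
  fun n => \sum_(k < n.+1) u k * v (n - k)%N.
Definition expnP (u : fpseries) (k : nat) : fpseries :=
  iter k (mulP u) (fun n => (n == 0%N)%:R).
(* u o v = \sum_k u_k v^k, where v^k starts at r^k if v has no constant term *)
Definition compP (u v : fpseries) : fpseries :=
  fun n => \sum_(k < n.+1) u k * expnP v k n.

(* The iterated integral over 0 <= s_1 <= ... <= s_k <= x of
   a_{i_k}(s_k) ... a_{i_1}(s_1), for the reversed word [:: i_k; ...; i_1]. *)
Fixpoint iter_int_rev (a : nat -> R -> cplx) (w : word) (x : R) : cplx :=
  if w is j :: w' then cintegral (fun s => a j s * iter_int_rev a w' s) x
  else 1.
Definition iter_int (T : R) (w : word) (a : nat -> R -> cplx) : cplx :=
  iter_int_rev a (rev w) T.

Definition is_Ihat (T : R) (w : word) (f : ncseries -> cplx) : Prop :=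
  {within formal_paths T, continuous f} /\
  forall a, pathX T a -> f (pathE T a) = iter_int T w a.
Definition Ihat (T : R) (w : word) : ncseries -> cplx := get (is_Ihat T w).

(* (t - i_1 + 1) (t - i_1 - i_2 + 1) ... (t - i_1 - ... - i_k + 1) *)
Definition pcoef (w : word) (t : cplx) : cplx :=
  \prod_(j < size w) (t - (weight (take j.+1 w))%:R + 1).

Definition Phat (T : R) (g : ncseries) : fpseries :=
  fun n => match n with
           | 0 => 0
           | 1 => 1
           | i.+1 => \sum_(w \in [set w : word | weight w = i])
                       pcoef w i%:R * Ihat T w g
           end.

(* phi is the isomorphism of topological groups from S to G[[r]] through which
   Phat factors. *)
Definition is_Phi (T : R) (phi : opseries -> fpseries) : Prop :=
  [/\ homeo_on (groupS T) groupGr phi,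
      {in groupS T &, forall f g, phi (mulS f g) = compP (phi f) (phi g)} &
      {in formal_paths T, forall g, Phat T g = phi (Psi g)}].
Definition Phi (T : R) : opseries -> fpseries := get (is_Phi T).

Definition formal_centers (T : R) : set ncseries :=
  [set g | formal_paths T g /\ Phat T g = idGr].

Definition PL : set ncseries := gen_subgroup (expA @` linL).

Definition centersPL (T : R) : set ncseries := formal_centers T `&` PL.

Definition TPL (T : R) (u : fpseries) : ncseries :=
  expA (mapA (logS ('pinv_(fun=> 0) (groupS T) (Phi T) u))).

End FormalPaths.

Arguments linL : clear implicits.
Arguments groupGr : clear implicits.
Arguments PL : clear implicits.

(* Main.v *)
(* The solution of F' = (sum_i a_i t^i X_i) F has iterated integrals as coefficients,
   and an Euler scheme with error O(1/n) on each coefficient shows that F(T) is a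
   limit of products of exponentials e^h, h in L; for piecewise constant a the scheme
   is exact on fine grids. Hence G_f(X) is the closure of PL, and the continuous extension of
   I_{i_1,...,i_k} is the coefficient at the reversed word.

   In the transposed representation on C[[r]], X_i becomes the derivation
   r^(i+1) d/dr, so every e^h acts by an algebra automorphism (Leibniz rule). The
   series acting on C[[r]] by algebra endomorphisms form a closed set stable under
   products, so this holds on G_f(X). Such an endomorphism is the substitution of the
   image of r, which is the first return map; therefore the first return map is a
   homomorphism on G_f(X) and determines Psi there, which yields Phi.

   A series r + d_1 r^2 + ... is the first return map of exactly one e^h with h in L:
   the coefficients of h are found recursively, each being a polynomial in the d_i,
   hence continuous. Calling this section s |-> e(s), the map g |-> e(P(g))^{-1} g is a
   continuous retraction of PL onto the centers in PL. This gives (1), and (3) because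
   PL is dense. For (2), e^a e^b = (e^a e^b e^{-s(a,b)}) e^{s(a,b)}, so that by induction
   every product of exponentials is a product of the generators times one
   exponential, which is trivial on the kernel of the first return map. *)

Require Import Defs.
From mathcomp Require Import all_boot all_order all_algebra complex.
From mathcomp Require Import all_classical all_reals all_analysis.
From mathcomp Require Import measurable_realfun ring zify.

Set Implicit Arguments.
Unset Strict Implicit.
Unset Printing Implicit Defensive.

Import Order.TTheory GRing.Theory Num.Theory.
Import numFieldNormedType.Exports.

Local Open Scope classical_set_scope.
Local Open Scope ring_scope.

(** * Noncommutative series *)

Section TriangularSums.
Variable V : nmodType.

(** Reindexing by m = j + a, used whenever two actions are composed or two exponential series are
    multiplied. *)
Lemma sum_triangle (n : nat) (F : nat -> nat -> V) :
  \sum_(j < n) \sum_(a < n - j) F j (j + a)%N =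
  \sum_(m < n) \sum_(j < m.+1) F j m.
Proof.
rewrite (eq_bigr (fun j : 'I_n => \sum_(m < n | (j <= m)%N) F j m)); last first.
  move=> j _; rewrite -(big_mkord xpredT (fun a => F j (j + a)%N)).
  rewrite -(big_mkord (fun m => j <= m)%N (fun m => F j m)).
  rewrite [RHS](@big_cat_nat _ _ _ j) ?leq0n 1?ltnW //= [X in X + _]big_nat_cond.
  rewrite [X in X + _]big1 ?add0r; last first.
    by move=> i /= Hi; have : false by move: Hi; lia.
  rewrite -[X in _ = \sum_(X <= i < n | _) _]add0n big_addn.
  rewrite [RHS]big_nat_cond [LHS]big_nat_cond.
  apply: eq_big => [i|i _]; last by rewrite addnC.
  by rewrite leq_addl andbT.
rewrite (exchange_big_dep xpredT) //=; apply: eq_bigr => m _.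
rewrite -(big_mkord (fun j => (j <= m)%N) (fun j => F j m)).
rewrite -(big_mkord xpredT (fun j => F j m)).
rewrite [LHS](@big_cat_nat _ _ _ m.+1) //= [X in _ + X]big_nat_cond.
rewrite [X in _ + X]big1 ?addr0; last first.
  by move=> i /= Hi; have : false by move: Hi; lia.
rewrite [LHS]big_nat_cond [RHS]big_nat_cond; apply: eq_bigl => i.
by rewrite leq0n /= ltnS andbT andbb.
Qed.

Lemma sum_ord_trunc (n m : nat) (F : nat -> V) : (n <= m)%N ->
  (forall i, (n <= i < m)%N -> F i = 0) -> \sum_(i < m) F i = \sum_(i < n) F i.
Proof.
move=> nm F0; rewrite -(big_mkord xpredT F) (@big_cat_nat _ _ _ n) //=.
rewrite big_mkord [X in _ + X]big_nat_cond [X in _ + X]big1 ?addr0 //.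
by move=> i /andP[/F0].
Qed.

End TriangularSums.

Section NCSeries.
Variable R : realType.
Notation C := (cplx R).
Implicit Types (f g h : ncseries R) (w : word) (c : nat -> C).

(** Peeling off the first letter turns identities about [mulNC] into inductions on words, through
    [mulNC_cons] and [lder_mulNC]. *)
Definition lder (j : nat) f : ncseries R := fun w => f (j :: w).

Lemma mulNC_nil f g : mulNC f g [::] = f [::] * g [::].
Proof. by rewrite /mulNC big_ord1. Qed.

Lemma mulNC_cons f g j w :
  mulNC f g (j :: w) = f [::] * g (j :: w) + mulNC (lder j f) g w.
Proof. by rewrite /mulNC big_ord_recl. Qed.

Lemma ncseriesD f g w : (f + g) w = f w + g w. Proof. by []. Qed.
Lemma ncseriesN f w : (- f) w = - f w. Proof. by []. Qed.
Lemma ncseriesZ (a : C) f w : (a *: f) w = a * f w. Proof. by []. Qed.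
Lemma ncseries_sum I (r : seq I) (P : pred I) (F : I -> ncseries R) w :
  (\sum_(i <- r | P i) F i) w = \sum_(i <- r | P i) F i w.
Proof. by elim/big_rec2: _ => //= i x y _ <-. Qed.

Lemma mulNCPl (a : C) f g h : mulNC (a *: f + g) h = a *: mulNC f h + mulNC g h.
Proof.
apply/funext => w; rewrite ncseriesD ncseriesZ /mulNC mulr_sumr -big_split /=.
by apply: eq_bigr => k _; rewrite ncseriesD ncseriesZ mulrDl mulrA.
Qed.

Lemma lder_mulNC f g j :
  lder j (mulNC f g) = f [::] *: lder j g + mulNC (lder j f) g.
Proof. by apply/funext => w; rewrite /lder mulNC_cons. Qed.

Lemma mulNCA f g h : mulNC f (mulNC g h) = mulNC (mulNC f g) h.
Proof.
apply/funext => w; elim: w f g h => [|j w IH] f g h.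
  by rewrite !mulNC_nil mulrA.
rewrite !mulNC_cons mulNC_nil IH lder_mulNC mulNCPl ncseriesD ncseriesZ.
by rewrite mulrDr !mulrA addrA.
Qed.

Lemma mul1NC f : mulNC (oneA R) f = f.
Proof.
apply/funext => w; rewrite /mulNC big_ord_recl /= take0 drop0 /oneA eqxx mul1r.
rewrite big1 ?addr0 // => i _; case: w i => [|j w] [i ilt] //.
by rewrite mul0r.
Qed.

Lemma mulNC1 f : mulNC f (oneA R) = f.
Proof.
apply/funext => w; elim: w f => [|j w IH] f; first by rewrite mulNC_nil mulr1.
by rewrite mulNC_cons IH /oneA /= mulr0 add0r.
Qed.

Lemma mulNC_lin_cons c f j w : mulNC (linA c) f (j :: w) = c j * f w.
Proof.
rewrite mulNC_cons mul0r add0r /mulNC big_ord_recl take0 drop0 /lder.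
by rewrite big1 ?addr0 // => i _; case: w i => [|k w] [i ilt] //; rewrite mul0r.
Qed.

Lemma linAN c : linA (fun j => - c j) = - linA c.
Proof. by apply/funext => -[|j [|k w]] //=; rewrite ncseriesN /= ?oppr0. Qed.

Lemma expnAS f k : expnA f k.+1 = mulNC f (expnA f k). Proof. by []. Qed.

Lemma expnA_short f k w : f [::] = 0 -> (size w < k)%N -> expnA f k w = 0.
Proof.
move=> f0; elim: k w => // k IH w; rewrite ltnS => wk.
rewrite expnAS /mulNC big_ord_recl take0 f0 mul0r add0r big1 // => i _.
by rewrite IH ?mulr0 // size_drop /= /bump /=; move: (ltn_ord i); lia.
Qed.

(** This provides one truncation index for all words of a given weight, as [mu_expA] requires. *)
Lemma expA_trunc f w n : f [::] = 0 -> (size w <= n)%N ->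
  expA f w = \sum_(k < n.+1) (k`!%:R)^-1 * expnA f k w.
Proof.
move=> f0 wn; rewrite /expA -(@sum_ord_trunc _ (size w).+1 n.+1
  (fun k => (k`!%:R)^-1 * expnA f k w)) // => i /andP[wi _].
by rewrite expnA_short ?mulr0.
Qed.

Lemma expA_nil f : expA f [::] = 1.
Proof. by rewrite /expA big_ord1 invr1 mul1r. Qed.

(* As k > 1 and there is no constant term, only the coefficients of f on words
   of length at most n contribute to that of f^k on a word of length n + 1. *)
Lemma expnA_eq f g n k w : f [::] = 0 -> g [::] = 0 ->
  (forall v, (size v <= n)%N -> f v = g v) -> (1 < k)%N -> (size w <= n.+1)%N ->
  expnA f k w = expnA g k w.
Proof.
move=> f0 g0 fg.
have agree j v : (size v <= n)%N -> expnA f j v = expnA g j v.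
  elim: j v => // j IH v vn; rewrite !expnAS /mulNC; apply: eq_bigr => i _.
  by rewrite fg ?IH // ?size_take_min ?size_drop; lia.
case: k => // k k0 wn; rewrite !expnAS /mulNC; apply: eq_bigr => i _.
have [i0|i0] := posnP i; first by rewrite i0 take0 f0 g0 !mul0r.
rewrite (agree k); last by rewrite size_drop; lia.
have [iw|iw] := ltnP i (size w); first by rewrite fg // size_takel; lia.
rewrite drop_oversize // (expnA_short (w:=[::])) // !mulr0 //.
Qed.

Definition wprod c w : C := \prod_(j <- w) c j.

Lemma expnA_linA c k w :
  expnA (linA c) k w = if size w == k then wprod c w else 0.
Proof.
rewrite /wprod; elim: k w => [|k IH] [|j w] //=; rewrite ?big_nil //.
  by rewrite mulNC_nil mul0r.
by rewrite mulNC_lin_cons IH eqSS big_cons; case: ifP; rewrite ?mulr0.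
Qed.

Lemma expA_linA c w : expA (linA c) w = wprod c w / (size w)`!%:R.
Proof.
rewrite /expA big_ord_recr /= expnA_linA eqxx big1 ?add0r 1?mulrC // => k _.
by rewrite expnA_linA gtn_eqF ?mulr0.
Qed.

Lemma wprodZ (a : C) c w : wprod (fun j => a * c j) w = a ^+ size w * wprod c w.
Proof.
rewrite /wprod; elim: w => [|j w IH]; rewrite ?big_nil ?mulr1 // !big_cons IH /=.
by rewrite exprS; ring.
Qed.

Lemma wprod_take_drop c k w : wprod c (take k w) * wprod c (drop k w) = wprod c w.
Proof. by rewrite /wprod -big_cat cat_take_drop. Qed.

(** The two exponents are multiples of the same [linA c], so the law reduces, word by word, to the
    binomial theorem. *)
Lemma expA_linA_mul (a b : C) c :
  mulNC (expA (linA (fun j => a * c j))) (expA (linA (fun j => b * c j))) =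
  expA (linA (fun j => (a + b) * c j)).
Proof.
apply/funext => w; rewrite /mulNC expA_linA wprodZ [a + b]addrC exprDn.
rewrite !mulr_suml; apply: eq_bigr => k _; rewrite !expA_linA !wprodZ.
rewrite size_takel ?size_drop -1?ltnS // -(wprod_take_drop c k w).
have kw : (k <= size w)%N by rewrite -ltnS.
have /(congr1 (fun n => n%:R : C)) := bin_fact kw.
rewrite !natrM => E.
have nz n : n`!%:R != 0 :> C by rewrite pnatr_eq0 -lt0n fact_gt0.
(* Here n! is replaced by the binomial coefficient times k! (n - k)!; that this coefficient is
   nonzero is then read off from n! being nonzero. *)
rewrite -mulr_natr -E.
field; rewrite !nz /= ?mulf_neq0 ?nz //.
move: (nz (size w)); rewrite -E !mulf_eq0 !negb_or => /and3P[? ? ?].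
by rewrite ?nz.
Qed.

Lemma expA_linA0 c : (forall j, c j = 0) -> expA (linA c) = oneA R.
Proof.
move=> c0; apply/funext => -[|j w]; first by rewrite expA_nil.
by rewrite expA_linA /wprod big_cons c0 !mul0r.
Qed.

Lemma expA_linAN c : mulNC (expA (linA (fun j => - c j))) (expA (linA c)) = oneA R.
Proof.
have := expA_linA_mul (-1) 1 c; rewrite addNr.
under [fun j => -1 * _]funext do rewrite mulN1r.
under [fun j => 1 * _]funext do rewrite mul1r.
by move=> ->; apply: expA_linA0 => j; rewrite mul0r.
Qed.

Lemma expA_linANr c : mulNC (expA (linA c)) (expA (linA (fun j => - c j))) = oneA R.
Proof.
by have := expA_linAN (fun j => - c j); under [fun j => - - _]funext do rewrite opprK.
Qed.

End NCSeries.

(** * Pointwise convergence *)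

Section Pointwise.
Context {I : Type} {K : topologicalType}.

(** The topology is a supremum of weak topologies, so only preimages of open sets under a single
    evaluation have to be tested. *)
Lemma ptws_cvgP (F : set_system {ptws I -> K}) (f : {ptws I -> K}) : Filter F ->
  (forall i, (g i @[g --> F]) --> f i) -> F --> f.
Proof.
move=> FF cvF; apply/cvg_sup => i A [B [[W oW <-] WfN WA]].
apply: (@filterS _ _ _ ((fun g : {ptws I -> K} => g i) @^-1` W)) => //.
exact/(cvF i)/open_nbhs_nbhs.
Qed.


Lemma ptws_eval_continuous i : continuous (fun f : {ptws I -> K} => f i).
Proof.
move=> f A; rewrite nbhsE => -[W [oW Wf] WA].
have /cvg_sup/(_ i) cvi : nbhs f --> f by apply: cvg_id.
apply: cvi; exists ((fun g : I -> K => g i) @^-1` W); split => //.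
  by exists W.
by move=> g /= /WA.
Qed.

Lemma ptws_continuousP {T : topologicalType} (G : T -> {ptws I -> K}) :
  (forall i, continuous (fun x => G x i)) -> continuous G.
Proof. by move=> cG x; apply: ptws_cvgP => i; exact: (cG i x). Qed.

End Pointwise.

(** * Identities and limits on closures *)

Section Closure.
Context {T U : topologicalType}.

(** Neighbourhoods of [f x] and [g x] always meet, at the common value of a point of [A] close to
    [x]. Continuity is relative to [D] because that is all that [is_Ihat] provides. *)
Lemma eq_on_closure (D A : set T) (f g : T -> U) : hausdorff_space U ->
  {within D, continuous f} -> {within D, continuous g} -> A `<=` D ->
  {in A, f =1 g} -> forall x, D x -> closure A x -> f x = g x.
Proof.
move=> hU /subspace_continuousP cf /subspace_continuousP cg AD fg x Dx Ax.
apply: hU => V W /(cf _ Dx) /= fV /(cg _ Dx) /= gW.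
have {}fV : nbhs x [set y | D y -> V (f y)] := fV.
have {}gW : nbhs x [set y | D y -> W (g y)] := gW.
have [y [Ay [Vy Wy]]] := Ax _ (filterI fV gW).
exists (f y); split; first exact/Vy/AD.
by rewrite fg ?inE //; exact/Wy/AD.
Qed.

Lemma eq_on_closureT (A : set T) (f g : T -> U) : hausdorff_space U ->
  continuous f -> continuous g -> {in A, f =1 g} ->
  forall x, closure A x -> f x = g x.
Proof.
move=> hU cf cg fg x.
have cT (h : T -> U) : continuous h -> {within setT, continuous h}.
  exact: continuous_subspaceT.
exact: (eq_on_closure hU (cT _ cf) (cT _ cg)).
Qed.

Lemma closure_cvg (A : set T) (u : nat -> T) x :
  (forall m, A (u m)) -> u @ \oo --> x -> closure A x.
Proof.
move=> uA ux B /ux /= [N _ NB]; exists (u N); split => //.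
by apply: NB => /=.
Qed.

End Closure.

(** * Continuity of complex-valued functions *)

Section ComplexContinuity.
Context {R : realType} {T : topologicalType}.
Notation C := (cplx R).

Lemma cplx_hausdorff : hausdorff_space C.
Proof. exact: (@norm_hausdorff C C). Qed.

Lemma cplx_sum_continuous I (r : seq I) (P : pred I) (F : I -> T -> C) :
  (forall i, P i -> continuous (F i)) ->
  continuous (fun x => \sum_(i <- r | P i) F i x).
Proof.
move=> cF x; apply: cvg_big => [|i Pi]; last exact: cF.
move=> y; apply: (@cvgD C C _ _ _ fst snd); [exact: cvg_fst|exact: cvg_snd].
Qed.

Lemma cplx_prod_continuous I (r : seq I) (P : pred I) (F : I -> T -> C) :
  (forall i, P i -> continuous (F i)) ->
  continuous (fun x => \prod_(i <- r | P i) F i x).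
Proof.
move=> cF x; apply: cvg_big => [|i Pi]; last exact: cF.
move=> y; apply: (@cvgM C _ _ _ fst snd); [exact: cvg_fst|exact: cvg_snd].
Qed.

Lemma cplxM_continuous (f g : T -> C) : continuous f -> continuous g ->
  continuous (fun x => f x * g x).
Proof. by move=> cf cg x; apply: (@cvgM C); [exact: cf|exact: cg]. Qed.

Lemma cplxB_continuous (f g : T -> C) : continuous f -> continuous g ->
  continuous (fun x => f x - g x).
Proof. by move=> cf cg x; apply: (@cvgB C C); [exact: cf|exact: cg]. Qed.

Lemma cplx_cst_continuous (a : C) : continuous (fun _ : T => a).
Proof. by move=> x; exact: cvg_cst. Qed.

Lemma cplxZl_continuous (a : C) (f : T -> C) : continuous f ->
  continuous (fun x => a * f x).
Proof. by move=> cf; apply: (cplxM_continuous _ cf) => x; exact: cvg_cst. Qed.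

Lemma cplxZr_continuous (a : C) (f : T -> C) : continuous f ->
  continuous (fun x => f x * a).
Proof. by move=> cf; apply: (cplxM_continuous cf) => x; exact: cvg_cst. Qed.

End ComplexContinuity.

(** * Action of words on power series *)

Section Words.

(** The fuel [k] makes the recursion structural, since the weight drops by more than one when the
    first letter is large; any [k >= n] gives the same list ([words_fuelE]). *)
Fixpoint words_fuel (k n : nat) : seq word :=
  if n is n'.+1 then
    if k is k'.+1 then
      flatten [seq [seq j :: w | w <- words_fuel k' (n' - j)%N] | j <- iota 0 n]
    else [::]
  else [:: [::]].
Definition words n := words_fuel n n.

Lemma weight_nil : weight [::] = 0%N. Proof. by rewrite /weight big_nil. Qed.
Lemma weight_cons j w : weight (j :: w) = (j.+1 + weight w)%N.
Proof. by rewrite /weight big_cons. Qed.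
Lemma weight_rev w : weight (rev w) = weight w.
Proof. by rewrite /weight; apply: perm_big; rewrite perm_rev. Qed.
Lemma size_weight w : (size w <= weight w)%N.
Proof. by elim: w => // j w IH; rewrite weight_cons /=; lia. Qed.

Lemma words_fuelS k n : words_fuel k.+1 n.+1 =
  flatten [seq [seq j :: w | w <- words_fuel k (n - j)] | j <- iota 0 n.+1].
Proof. by []. Qed.

Lemma words_fuelE k n : (n <= k)%N -> words_fuel k n = words n.
Proof.
rewrite /words; have [m] := ubnP n; elim: m n k => // m IH [|n] [|k] // nm nk.
rewrite !words_fuelS; apply: (congr1 flatten); apply: eq_map => j.
by apply: (congr1 (map _)); rewrite (IH _ k) ?(IH _ n) //; lia.
Qed.

Lemma words0 : words 0 = [:: [::]]. Proof. by []. Qed.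
Lemma wordsS n : words n.+1 =
  flatten [seq [seq j :: w | w <- words (n - j)] | j <- iota 0 n.+1].
Proof.
rewrite {1}/words words_fuelS; apply: (congr1 flatten); apply: eq_map => j.
by apply: (congr1 (map _)); rewrite words_fuelE //; lia.
Qed.

Lemma mem_words n w : (w \in words n) = (weight w == n).
Proof.
elim/ltn_ind: n w => -[|n] IH w.
  by rewrite words0 inE; case: w => [|j w]; rewrite ?weight_nil // weight_cons.
rewrite wordsS; case: w => [|j w].
  by rewrite weight_nil; apply/flatten_mapP => -[j _ /mapP[]].
rewrite weight_cons addSn eqSS; apply/flatten_mapP/eqP => [H|wn].
  case: H => i; rewrite mem_iota add0n ltnS /= => ilt /mapP[v + [-> ->]].
  by rewrite IH; [move=> /eqP ->|]; lia.
exists j; first by rewrite mem_iota; lia.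
by apply: map_f; rewrite IH; lia.
Qed.

Lemma uniq_words n : uniq (words n).
Proof.
elim/ltn_ind: n => -[|n] IH //; rewrite wordsS.
rewrite (allpairs_uniq_dep (f := fun j w => j :: w)) ?iota_uniq //.
- by move=> j _; apply: IH; lia.
- by move=> [i v] [j w] _ _ /= [-> ->].
Qed.

Lemma sum_wordsS (V : nmodType) n (F : word -> V) :
  \sum_(w <- words n.+1) F w =
  \sum_(j < n.+1) \sum_(w <- words (n - j)) F (nat_of_ord j :: w).
Proof.
rewrite wordsS big_flatten big_map -[n.+1 in LHS]subn0.
rewrite -(big_mkord xpredT (fun j => \sum_(w <- words (n - j)) F (j :: w))).
by apply: eq_bigr => j _; rewrite big_map.
Qed.

Lemma set_words n : [set` words n] = [set w : word | weight w = n].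
Proof. by apply/seteqP; split => w /=; rewrite mem_words => /eqP. Qed.

End Words.

(** * The transposed representation on power series *)

Section Action.
Variable R : realType.
Notation C := (cplx R).
Implicit Types (f g h : ncseries R) (u v : fpseries R) (w : word) (c : nat -> C).

(* The letter j acts on C[[r]] as the derivation r^(j+2) d/dr, which is the
   transpose of D L^j when r^(k+1) is paired with z^k; applying the letters of w
   from left to right maps r^p to [qcoef w p] r^(p + weight w). *)
Fixpoint qcoef (w : word) (p : nat) : nat :=
  if w is j :: w' then (p * qcoef w' (p + j.+1))%N else 1%N.

(** The part of weight [n] of [f] sends r^p to [mu f n p] times r^(p + n). *)
Definition mu f n p : C := \sum_(w <- words n) f w * (qcoef w p)%:R.

Lemma mu0 f p : mu f 0 p = f [::].
Proof. by rewrite /mu words0 big_seq1 mulr1. Qed.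

Lemma muS f n p :
  mu f n.+1 p = \sum_(j < n.+1) p%:R * mu (lder j f) (n - j) (p + j.+1).
Proof.
rewrite /mu sum_wordsS; apply: eq_bigr => j _; rewrite mulr_sumr.
by apply: eq_bigr => w _; rewrite /= natrM mulrCA.
Qed.

Lemma muP (a : C) f g n p : mu (a *: f + g) n p = a * mu f n p + mu g n p.
Proof.
rewrite /mu mulr_sumr -big_split /=; apply: eq_bigr => w _.
by rewrite ncseriesD ncseriesZ mulrDl mulrA.
Qed.

Lemma mu_at0 f n : mu f n 0 = (n == 0%N)%:R * f [::].
Proof.
case: n => [|n]; first by rewrite mu0 mul1r.
by rewrite muS mul0r big1 // => j _; rewrite mul0r.
Qed.

(** The left factor acts first and raises the exponent from p to p + a, where the right factor takes
    over. The induction peels off the first letter. *)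
Lemma mu_mulNC f g n p :
  mu (mulNC f g) n p = \sum_(a < n.+1) mu f a p * mu g (n - a) (p + a).
Proof.
elim/ltn_ind: n f p => -[|n] IH f p.
  by rewrite big_ord1 !mu0 mulNC_nil.
rewrite big_ord_recl mu0 subn0 addn0 !muS mulr_sumr.
under eq_bigr => j _ do rewrite lder_mulNC muP mulrDr IH ?ltnS ?leq_subr //.
rewrite big_split /=; congr (_ + _).
  by apply: eq_bigr => j _; rewrite mulrCA.
(* In [F j m] the letter [j] comes first, and [m.+1] is the total weight used by the left factor,
   that letter included. *)
pose F j m := p%:R * (mu (lder j f) (m - j) (p + j.+1) * mu g (n - m) (p + m.+1)).
transitivity (\sum_(j < n.+1) \sum_(a < n.+1 - j) F j (j + a)%N).
  apply: eq_bigr => j _; rewrite mulr_sumr subSn -1?ltnS //.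
  apply: eq_bigr => a _; rewrite /F addKn subnDA.
  by congr (_ * (_ * mu _ _ _)); lia.
rewrite sum_triangle; apply: eq_bigr => m _.
rewrite /bump /= add1n muS mulr_suml; apply: eq_bigr => j _.
by rewrite /F mulrA subSS.
Qed.

Lemma mu_continuous n p : continuous (fun f : ncseries R => mu f n p).
Proof.
apply: cplx_sum_continuous => w _; apply: cplxZr_continuous.
exact: ptws_eval_continuous.
Qed.

(* The transpose of Psi f: an anti-representation on C[[r]]. *)
Definition Theta f u : fpseries R :=
  fun N => \sum_(k < N.+1) u k * mu f (N - k) k.

Lemma Theta_mulNC f g u : Theta (mulNC f g) u = Theta g (Theta f u).
Proof.
apply/funext => N; rewrite /Theta.
pose F a k := u a * mu f (k - a) a * mu g (N - k) k.
transitivity (\sum_(a < N.+1) \sum_(b < N.+1 - a) F a (a + b)%N).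
  apply: eq_bigr => a _; rewrite mu_mulNC mulr_sumr subSn -1?ltnS //.
  by apply: eq_bigr => b _; rewrite /F addKn subnDA mulrA.
rewrite sum_triangle; apply: eq_bigr => k _; rewrite mulr_suml.
by apply: eq_bigr.
Qed.

Lemma Theta1 u : Theta (oneA R) u = u.
Proof.
apply/funext => N; rewrite /Theta big_ord_recr /= subnn mu0 mulr1 big1 ?add0r //.
move=> k _; rewrite -[(N - k)%N]prednK ?subn_gt0 // muS big1 ?mulr0 // => j _.
by rewrite /mu big1 ?mulr0 // => w _; rewrite mul0r.
Qed.

Lemma mu_linA c n p : mu (linA c) n.+1 p = p%:R * c n.
Proof.
rewrite muS big_ord_recr /= subnn mu0 /= big1 ?add0r // => j _.
rewrite -[(_ - j)%N]prednK ?subn_gt0 // /mu big_seq big1 ?mulr0 // => -[|i w].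
  by rewrite mem_words weight_nil.
by move=> _; rewrite /lder /= mul0r.
Qed.

Lemma Theta_lin c u N :
  Theta (linA c) u N = \sum_(k < N) (k%:R * u k) * c (N - k).-1.
Proof.
rewrite /Theta big_ord_recr /= subnn mu0 mulr0 addr0; apply: eq_bigr => k _.
by rewrite -{1}[(N - k)%N]prednK ?subn_gt0 // mu_linA mulrA [u k * _]mulrC.
Qed.

Lemma Theta_continuous u N : continuous (fun f : ncseries R => Theta f u N).
Proof.
apply: cplx_sum_continuous => k _; apply: cplxZl_continuous.
exact: mu_continuous.
Qed.

Lemma mu_expA f n p : f [::] = 0 ->
  mu (expA f) n p = \sum_(k < n.+1) (k`!%:R)^-1 * mu (expnA f k) n p.
Proof.
move=> f0; rewrite /mu.
under [RHS]eq_bigr => k _ do rewrite mulr_sumr.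
rewrite exchange_big /= big_seq [RHS]big_seq; apply: eq_bigr => w.
rewrite mem_words => /eqP wn; rewrite (@expA_trunc _ _ _ n) // -?wn ?size_weight //.
by rewrite mulr_suml; apply: eq_bigr => k _; rewrite mulrA.
Qed.

Lemma mu_expnA_short f n k p : f [::] = 0 -> (n < k)%N -> mu (expnA f k) n p = 0.
Proof.
move=> f0 nk; rewrite /mu big_seq big1 // => w; rewrite mem_words => /eqP wn.
by rewrite expnA_short ?mul0r // (leq_ltn_trans (size_weight _)) // wn.
Qed.

Lemma Theta_expA f u N n : f [::] = 0 -> (N <= n)%N ->
  Theta (expA f) u N = \sum_(k < n.+1) (k`!%:R)^-1 * Theta (expnA f k) u N.
Proof.
move=> f0 Nn; rewrite /Theta.
under [RHS]eq_bigr => k _ do rewrite mulr_sumr.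
rewrite exchange_big /=; apply: eq_bigr => a _; rewrite mu_expA //.
rewrite [RHS](@sum_ord_trunc _ (N - a).+1 n.+1
  (fun i => i`!%:R^-1 * (u a * mu (expnA f i) (N - a) a))); last 2 first.
- by lia.
- by move=> i /andP[ai _]; rewrite mu_expnA_short ?mulr0.
by rewrite mulr_sumr; apply: eq_bigr => k _; rewrite mulrCA.
Qed.

Lemma Theta_expnA_short f u N k : f [::] = 0 -> (N < k)%N ->
  Theta (expnA f k) u N = 0.
Proof.
by move=> f0 Nk; rewrite /Theta big1 // => a _; rewrite mu_expnA_short ?mulr0 //; lia.
Qed.

End Action.

(** * Substitutions of formal power series *)

Section Recursion.
Variables (I : Type) (V : zmodType) (rank : I -> nat).

Definition rank_fix (K : (I -> V) -> I -> V) : I -> V :=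
  fun i => iter (rank i).+1 K (fun=> 0) i.

(** Values at rank below [m] no longer change after [m] iterations of [K], so that iterating
    [(rank i).+1] times replaces a well-founded recursion. *)
Lemma rank_fixE (K : (I -> V) -> I -> V) :
  (forall f g i, (forall j, (rank j < rank i)%N -> f j = g j) -> K f i = K g i) ->
  rank_fix K = K (rank_fix K).
Proof.
move=> Kloc; apply/funext => i.
suff E m j : (rank j < m)%N -> iter m K (fun=> 0) j = rank_fix K j.
  by rewrite {1}/rank_fix iterS; apply: Kloc => j /E.
rewrite /rank_fix; elim/ltn_ind: m j => -[|m] // IH j jm.
rewrite !iterS; apply: Kloc => l lj.
by rewrite !IH //; lia.
Qed.

End Recursion.

Section FormalDiffeos.
Variable R : realType.
Notation C := (cplx R).
Implicit Types (f g h : ncseries R) (u v : fpseries R) (w : word) (c : nat -> C).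

Lemma fpseriesD u v n : (u + v) n = u n + v n. Proof. by []. Qed.
Lemma fpseriesZ (a : C) u n : (a *: u) n = a * u n. Proof. by []. Qed.
Lemma fpseries_sum I (r : seq I) (P : pred I) (F : I -> fpseries R) n :
  (\sum_(i <- r | P i) F i) n = \sum_(i <- r | P i) F i n.
Proof. by elim/big_rec2: _ => //= i x y _ <-. Qed.

Lemma Theta_linear f (a : C) u v :
  Theta f (a *: u + v) = a *: Theta f u + Theta f v.
Proof.
apply/funext => N; rewrite fpseriesD fpseriesZ /Theta mulr_sumr -big_split /=.
by apply: eq_bigr => k _; rewrite fpseriesD fpseriesZ mulrDl mulrA.
Qed.

Lemma Theta_sum f (I : Type) (r : seq I) (F : I -> fpseries R) :
  Theta f (\sum_(i <- r) F i) = \sum_(i <- r) Theta f (F i).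
Proof.
apply/funext => N; rewrite fpseries_sum /Theta exchange_big /=.
by apply: eq_bigr => k _; rewrite fpseries_sum mulr_suml.
Qed.

(** Passing to polynomials that agree up to degree [N] gives access to the ring laws and the
    derivative of [{poly C}]. *)
Lemma mulP_coef u v (p q : {poly C}) N :
  (forall k, (k <= N)%N -> p`_k = u k) -> (forall k, (k <= N)%N -> q`_k = v k) ->
  mulP u v N = (p * q)`_N.
Proof.
move=> pu qv; rewrite coefM; apply: eq_bigr => k _.
by rewrite pu ?qv ?leq_subr // -ltnS.
Qed.

Lemma mulPZ (a b : C) u v : mulP (a *: u) (b *: v) = (a * b) *: mulP u v.
Proof.
apply/funext => N; rewrite fpseriesZ /mulP mulr_sumr; apply: eq_bigr => k _.
by rewrite !fpseriesZ mulrACA.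
Qed.

(** [Theta (linA c)] is the vector field W d/dr, where W is the sum of the c_j r^(j+2). As W starts
    at r^2, knowing [p] up to degree [N] is enough although [p] is differentiated. *)
Lemma Theta_lin_coef c u (p : {poly C}) N : (forall k, (k <= N)%N -> p`_k = u k) ->
  Theta (linA c) u N =
  (\poly_(i < N.+1) (if i is j.+2 then c j else 0) * p^`())`_N.
Proof.
move=> pu; rewrite Theta_lin coefMr.
case: N pu => [|N] pu.
  by rewrite big_ord0 big_ord1 coef_poly /= mul0r.
rewrite big_ord_recl !mul0r add0r.
(* The last two terms carry the coefficients of W at r^0 and r^1, which vanish. *)
rewrite [RHS]big_ord_recr /= coef_poly subnn mul0r addr0.
rewrite [RHS]big_ord_recr /= coef_poly subSnn /= mul0r addr0.
apply: eq_bigr => k _; rewrite /bump /= add1n coef_poly coef_deriv pu ?ltnS //.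
rewrite leq_subr.
have -> : (N.+1 - k = (N - k.+1).+2)%N by have := ltn_ord k; lia.
  by rewrite /= subSS mulr_natl mulrC; congr (c _ * _); lia.
exact: ltnW.
Qed.

Lemma Theta_lin_Leibniz c u v : Theta (linA c) (mulP u v) =
  mulP (Theta (linA c) u) v + mulP u (Theta (linA c) v).
Proof.
apply/funext => N; rewrite fpseriesD.
pose tr u : {poly C} := \poly_(i < N.+1) u i.
have trE u' k : (k <= N)%N -> (tr u')`_k = u' k.
  by move=> kN; rewrite coef_poly ltnS kN.
pose W : {poly C} := \poly_(i < N.+1) (if i is j.+2 then c j else 0).
have ThE u' k : (k <= N)%N -> (W * (tr u')^`())`_k = Theta (linA c) u' k.
  move=> kN; rewrite (@Theta_lin_coef _ _ (tr u')); last first.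
    by move=> l lk; rewrite trE //; lia.
  rewrite !coefM; apply: eq_bigr => i _; congr (_ * _); rewrite !coef_poly ltn_ord.
  by rewrite (leq_trans (ltn_ord i)).
rewrite (@Theta_lin_coef _ _ (tr u * tr v)); last first.
  by move=> k kN; symmetry; apply: mulP_coef => l lk; rewrite trE //; lia.
rewrite (@mulP_coef _ _ (W * (tr u)^`()) (tr v)) //;
  try by move=> k kN; rewrite ?trE ?ThE.
rewrite (@mulP_coef _ _ (tr u) (W * (tr v)^`())) //;
  try by move=> k kN; rewrite ?trE ?ThE.
rewrite derivM -coefD -/W.
by have -> : W * ((tr u)^`() * tr v + tr u * (tr v)^`()) =
  W * (tr u)^`() * tr v + tr u * (W * (tr v)^`()) by ring.
Qed.

Lemma expnASr f k : expnA f k.+1 = mulNC (expnA f k) f.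
Proof.
elim: k => [|k IH]; first by rewrite /expnA /= mulNC1 mul1NC.
by rewrite expnAS {1}IH mulNCA -expnAS.
Qed.

(** The term V^k u / k! of the exponential series of V = [Theta (linA c)]. Dividing by k! removes
    the binomial coefficients from the iterated Leibniz rule. *)
Definition divided_power c k u : fpseries R :=
  (k`!%:R)^-1 *: Theta (expnA (linA c) k) u.

Lemma divided_powerS c k u :
  k.+1%:R *: divided_power c k.+1 u = Theta (linA c) (divided_power c k u).
Proof.
rewrite /divided_power expnASr Theta_mulNC.
have := Theta_linear (linA c) (k`!%:R)^-1 (Theta (expnA (linA c) k) u) 0.
have -> : Theta (linA c) 0 = 0.
  by apply/funext => N; rewrite /Theta big1 // => i _; rewrite mul0r.
rewrite !addr0 => ->; rewrite scalerA factS natrM invfM mulrA divff ?mul1r //.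
Qed.

(** Induction on [n], after multiplication by n + 1. The Leibniz rule produces two shifted sums with
    weights i and n + 1 - i, which add up to n + 1. *)
Lemma divided_power_mulP c n u v : divided_power c n (mulP u v) =
  \sum_(i < n.+1) mulP (divided_power c i u) (divided_power c (n - i) v).
Proof.
elim: n => [|n IH].
  rewrite big_ord1 /divided_power /= invr1 !scale1r /expnA /=.
  by rewrite !Theta1.
have n0 : n.+1%:R != 0 :> C by rewrite pnatr_eq0.
apply: (scalerI n0); rewrite divided_powerS IH Theta_sum.
rewrite (eq_bigr (fun i : 'I_n.+1 =>
   i.+1%:R *: mulP (divided_power c i.+1 u) (divided_power c (n - i) v) +
   (n - i).+1%:R *: mulP (divided_power c i u) (divided_power c (n - i).+1 v))).
  rewrite big_split /= scaler_sumr.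
  have -> : \sum_(i < n.+1) i.+1%:R *:
      mulP (divided_power c i.+1 u) (divided_power c (n - i) v) =
    \sum_(i < n.+2) i%:R *:
      mulP (divided_power c i u) (divided_power c (n.+1 - i) v).
    rewrite [RHS]big_ord_recl scale0r add0r; apply: eq_bigr => i _.
    by rewrite lift0 subSS.
  have -> : \sum_(i < n.+1) (n - i).+1%:R *:
      mulP (divided_power c i u) (divided_power c (n - i).+1 v) =
    \sum_(i < n.+2) (n.+1 - i)%:R *:
      mulP (divided_power c i u) (divided_power c (n.+1 - i) v).
    rewrite [RHS]big_ord_recr /= subnn scale0r addr0; apply: eq_bigr => i _.
    by rewrite subSn // -ltnS.
  rewrite -big_split /=; apply: eq_bigr => i _.
  by rewrite -scalerDl -natrD subnKC // -ltnS.
move=> i _; rewrite Theta_lin_Leibniz -!divided_powerS.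
by have := mulPZ i.+1%:R 1 (divided_power c i.+1 u) (divided_power c (n - i) v);
   have := mulPZ 1 (n - i).+1%:R (divided_power c i u) (divided_power c (n - i).+1 v);
   rewrite !scale1r mulr1 mul1r => -> ->.
Qed.

Lemma divided_power_short c k u N : (N < k)%N -> divided_power c k u N = 0.
Proof. by move=> Nk; rewrite /divided_power fpseriesZ Theta_expnA_short ?mulr0. Qed.

(* Theta f is an algebra endomorphism of C[[r]], hence the substitution of
   [first_return f] for r (see Theta_compP); group-like series have this property. *)
Definition substitution_like f : Prop :=
  f [::] = 1 /\ forall u v, Theta f (mulP u v) = mulP (Theta f u) (Theta f v).

(** The exponential of a derivation is multiplicative: by [divided_power_mulP] the claim is a Cauchy
    product, finite in each degree. *)
Lemma substitution_like_exp c : substitution_like (expA (linA c)).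
Proof.
split; first exact: expA_nil.
have expE u N n : (N <= n)%N ->
    Theta (expA (linA c)) u N = \sum_(k < n.+1) divided_power c k u N.
  by move=> /(Theta_expA u) -> //; apply: eq_bigr.
move=> u v; apply/funext => N; rewrite (expE _ _ N) //.
under eq_bigr => k _ do rewrite divided_power_mulP fpseries_sum.
pose F i m := mulP (divided_power c i u) (divided_power c (m - i) v) N.
rewrite -(sum_triangle N.+1 F) /F /mulP.
rewrite [RHS](eq_bigr (fun M : 'I_N.+1 => \sum_(i < N.+1) \sum_(j < N.+1)
    divided_power c i u M * divided_power c j v (N - M)%N)); last first.
  move=> M _; rewrite !(expE _ _ N) ?leq_subr // -1?ltnS // mulr_suml.
  by apply: eq_bigr => i _; rewrite mulr_sumr.
rewrite [RHS]exchange_big /=; apply: eq_bigr => i _.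
rewrite [RHS]exchange_big /= [RHS](@sum_ord_trunc _ (N.+1 - i) N.+1 (fun j =>
   \sum_(M < N.+1) divided_power c i u M * divided_power c j v (N - M)%N)).
- by apply: eq_bigr => j _; apply: eq_bigr => M _; rewrite addKn.
- by rewrite leq_subr.
(* Here i + j > N, hence M < i or N - M < j, and one of the two divided powers vanishes. *)
move=> j /andP[ij _]; rewrite big1 // => M _.
have [Mi|iM] := ltnP M i; first by rewrite divided_power_short ?mul0r.
by rewrite [X in _ * X]divided_power_short ?mulr0 //; have := ltn_ord i; lia.
Qed.

Lemma substitution_like_mul f g : substitution_like f -> substitution_like g ->
  substitution_like (mulNC f g).
Proof.
move=> [f1 fM] [g1 gM]; split; first by rewrite mulNC_nil f1 g1 mulr1.
by move=> u v; rewrite !Theta_mulNC fM gM.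
Qed.

(** Both conditions equate continuous functions of [f], one coefficient at a time. *)
Lemma substitution_like_closure (A : set (ncseries R)) :
  A `<=` substitution_like -> closure A `<=` substitution_like.
Proof.
move=> AS f Af.
have main (G H : ncseries R -> C) : continuous G -> continuous H ->
    {in A, G =1 H} -> G f = H f.
  by move=> cG cH GH; apply: eq_on_closureT cplx_hausdorff cG cH GH _ Af.
split.
  apply: (main (fun f => f [::]) (fun=> 1)).
  - exact: ptws_eval_continuous.
  - exact: cst_continuous.
  - by move=> g; rewrite inE => /AS[].
move=> u v; apply/funext => N.
apply: (main (fun f => Theta f (mulP u v) N) (fun f => mulP (Theta f u) (Theta f v) N)).
- exact: Theta_continuous.
- apply: cplx_sum_continuous => k _.
  by apply: (@cplxM_continuous _ _ (fun f => Theta f u k)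
    (fun f => Theta f v (N - k)%N)); exact: Theta_continuous.
- by move=> g; rewrite inE => /AS[_ ->].
Qed.

Definition first_return f : fpseries R := Theta f (idGr R).

Lemma first_returnE f N :
  first_return f N = if N is n.+1 then mu f n 1 else 0.
Proof.
rewrite /first_return /Theta /idGr; case: N => [|n]; first by rewrite big_ord1 mul0r.
rewrite big_ord_recl mul0r add0r big_ord_recl /= mul1r subSS subn0 big1 ?addr0 //.
by move=> k _; rewrite mul0r.
Qed.

Lemma first_return_continuous : continuous first_return.
Proof. by apply: ptws_continuousP => N; exact: Theta_continuous. Qed.

Lemma first_return_groupGr f : f [::] = 1 -> groupGr R (first_return f).
Proof. by move=> f1; split; rewrite first_returnE // mu0. Qed.

Lemma expnP_idGr k n : expnP (idGr R) k n = (n == k)%:R.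
Proof.
elim: k n => [|k IH] n //=; rewrite /mulP /idGr; case: n => [|n].
  by rewrite big_ord1 mul0r.
rewrite big_ord_recl mul0r add0r big_ord_recl /= mul1r IH subSS subn0 big1 ?addr0 //.
by move=> i _; rewrite mul0r.
Qed.

Lemma Theta_expnP f u k : substitution_like f ->
  Theta f (expnP u k) = expnP (Theta f u) k.
Proof.
move=> [f1 fM]; elim: k => [|k IH]; last by rewrite /= fM -IH.
apply/funext => N; rewrite /Theta big_ord_recl mul1r big1 ?addr0 /=; last first.
  by move=> k _; rewrite mul0r.
by rewrite subn0 mu_at0 f1 mulr1.
Qed.

(** An endomorphism sends r^p to the p-th power of the image of r; therefore the first return map
    determines all [mu f n p]. *)
Lemma substitution_like_mu f n p : substitution_like f ->
  mu f n p = expnP (first_return f) p (n + p)%N.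
Proof.
move=> fS; rewrite -Theta_expnP // /Theta (bigD1 (inord p)) //= big1 => [|k].
  by rewrite expnP_idGr inordK ?ltnS ?leq_addl // eqxx mul1r addnK addr0.
rewrite expnP_idGr -val_eqE /= inordK ?ltnS ?leq_addl // => /negPf ->.
by rewrite mul0r.
Qed.

Lemma Theta_compP f u : substitution_like f ->
  Theta f u = compP u (first_return f).
Proof.
move=> fS; apply/funext => N; apply: eq_bigr => k _.
by rewrite substitution_like_mu // subnK // -ltnS.
Qed.

(** [Theta] reverses products and substitution reverses compositions, so the order of the factors is
    kept. *)
Lemma first_return_mulNC f g : substitution_like g ->
  first_return (mulNC f g) = compP (first_return f) (first_return g).
Proof. by move=> gS; rewrite /first_return Theta_mulNC Theta_compP. Qed.

Lemma first_return_inj f g : substitution_like f -> substitution_like g ->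
  first_return f = first_return g -> forall n p, mu f n p = mu g n p.
Proof. by move=> fS gS fg n p; rewrite !substitution_like_mu ?fg. Qed.

(* The coefficient of r^(m+2) in the first return map of e^(linA c) is c m plus a
   polynomial in the c j with j < m: a one-letter word of weight m + 1 is [:: m], and
   all other words of that weight have smaller letters. *)
Definition higher_part c m : C :=
  \sum_(w <- words m.+1 | w != [:: m])
    wprod c w / (size w)`!%:R * (qcoef w 1)%:R.

Lemma higher_part_eq c c' m : (forall j, (j < m)%N -> c j = c' j) ->
  higher_part c m = higher_part c' m.
Proof.
move=> cc'; rewrite /higher_part big_seq_cond [RHS]big_seq_cond.
apply: eq_bigr => w /andP[]; rewrite mem_words => /eqP wm wn; congr (_ / _ * _).
rewrite /wprod big_seq [RHS]big_seq; apply: eq_bigr => j jw; apply: cc'.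
case/splitPr: jw wm wn => w1 w2; rewrite /weight big_cat big_cons /= -!/(weight _).
move=> E; rewrite ltn_neqAle => N; apply/andP; split; last by lia.
(* A letter equal to [m] already has weight m + 1, so [w1] and [w2] are empty and the word is the
   excluded [[:: m]]. *)
apply: contra N => /eqP jm; have := size_weight w1; have := size_weight w2.
by case: w1 E => [|a w1]; case: w2 => [|b w2] /=; rewrite ?jm //; lia.
Qed.

Lemma first_return_exp c m :
  first_return (expA (linA c)) m.+2 = c m + higher_part c m.
Proof.
rewrite first_returnE /mu (bigD1_seq [:: m]) ?uniq_words //=; last first.
  by rewrite mem_words weight_cons weight_nil addn0.
congr (_ + _); first by rewrite expA_linA /wprod big_seq1 divr1 muln1 mulr1.
by apply: eq_bigr => w _; rewrite expA_linA.
Qed.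

(** Solves [first_return_exp] for [c], each coordinate being given by the previous ones. *)
Definition log_coords u : nat -> C :=
  rank_fix id (fun c m => u m.+2 - higher_part c m).

Lemma log_coordsE u m : log_coords u m = u m.+2 - higher_part (log_coords u) m.
Proof.
rewrite {1}/log_coords rank_fixE // => c c' i cc'.
by rewrite (higher_part_eq cc').
Qed.

Lemma first_return_log_coords u : groupGr R u ->
  first_return (expA (linA (log_coords u))) = u.
Proof.
move=> [u0 u1]; apply/funext => -[|[|m]]; first by rewrite first_returnE u0.
  by rewrite first_returnE mu0 expA_nil u1.
by rewrite first_return_exp log_coordsE subrK.
Qed.

Lemma first_return_exp_inj c c' :
  first_return (expA (linA c)) = first_return (expA (linA c')) -> c = c'.
Proof.
move=> E; apply/funext; elim/ltn_ind => m IH.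
move/(congr1 (fun u => u m.+2)): E; rewrite !first_return_exp.
by rewrite (higher_part_eq IH) => /addIr.
Qed.

Lemma log_coords_continuous m : continuous (fun u => log_coords u m).
Proof.
elim/ltn_ind: m => m IH.
(* Coordinates from [m] on are replaced by 0, which [higher_part] does not notice, so that the
   induction hypothesis covers every factor. *)
rewrite (_ : (fun u => _) = fun u : fpseries R => u m.+2 -
  \sum_(w <- words m.+1 | w != [:: m]) wprod
     (fun j => if (j < m)%N then log_coords u j else 0) w /
     (size w)`!%:R * (qcoef w 1)%:R); last first.
  apply/funext => u; rewrite log_coordsE; congr (_ - _).
  by apply: higher_part_eq => j ->.
apply: (@cplxB_continuous _ _ (fun u : fpseries R => u m.+2));
  first exact: ptws_eval_continuous.
apply: cplx_sum_continuous => w _; do 2 apply: cplxZr_continuous.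
apply: (@cplx_prod_continuous _ _ _ w xpredT
  (fun j u => if (j < m)%N then log_coords u j else 0)) => j _.
have [jm|_] := ltnP j m; first exact: (IH _ jm).
exact: (@cplx_cst_continuous R (fpseries R) 0).
Qed.

(** The scalar is 1 for [exp_of] and -1 for [exp_inv_of]. *)
Lemma exp_log_coords_continuous (s : C) :
  continuous (fun u => expA (linA (fun j => s * log_coords u j))).
Proof.
apply: ptws_continuousP => w.
under [X in continuous X]funext do rewrite expA_linA.
apply: cplxZr_continuous.
apply: cplx_prod_continuous => j _; apply: cplxZl_continuous.
exact: log_coords_continuous.
Qed.

Lemma mulNC_continuous (T : topologicalType) (F G : T -> ncseries R) :
  continuous F -> continuous G -> continuous (fun x => mulNC (F x) (G x)).
Proof.
move=> cF cG; apply: ptws_continuousP => w; apply: cplx_sum_continuous => k _.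
apply: (@cplxM_continuous _ _ (fun x => F x (take k w))
  (fun x => G x (drop k w))) => x.
  apply: (@continuous_comp _ _ _ F (fun f : ncseries R => f (take k w))); first exact: cF.
  exact: ptws_eval_continuous.
apply: (@continuous_comp _ _ _ G (fun f : ncseries R => f (drop k w))); first exact: cG.
exact: ptws_eval_continuous.
Qed.

End FormalDiffeos.

(** * The homomorphism Psi and the exponential maps *)

Section PsiConstruction.
Variable R : realType.
Notation C := (cplx R).
Implicit Types (f g h : ncseries R) (u v : fpseries R) (w : word) (c : nat -> C).

(** The product (k + 1) ... (k + i), which is the factor that D^i puts in front of the coefficient
    of index k + i. *)
Fixpoint rising (i k : nat) : nat :=
  if i is i'.+1 then (k.+1 * rising i' k.+1)%N else 1%N.

Lemma risingS i k : rising i.+1 k = (rising i k * (k + i.+1))%N.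
Proof.
elim: i k => [|i IH] k; first by rewrite /= muln1 mul1n addn1.
rewrite -[LHS]/(k.+1 * rising i.+1 k.+1)%N IH mulnA; congr (_ * _)%N.
by rewrite addSnnS.
Qed.

Lemma rising_shift i k :
  rising i.+1 k.+1 = (rising i.+1 k + i.+1 * rising i k.+1)%N.
Proof. by rewrite {1}risingS /=; ring. Qed.

Lemma iter_opL m u k : iter m (@opL R) u k = u (k + m)%N.
Proof. by elim: m k => [|m IH] k; rewrite ?addn0 //= /opL IH addSnnS. Qed.

Lemma iter_opD_opL i m u k :
  iter i (@opD R) (iter m (@opL R) u) k = (rising i k)%:R * u (k + i + m)%N.
Proof.
elim: i k => [|i IH] k; first by rewrite addn0 mul1r /= iter_opL.
by rewrite iterS {1}/opD IH mulrA -natrM addSnnS.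
Qed.

(* [p] is a polynomial function of degree at most [n]. *)
Definition rising_span n (p : nat -> C) : Prop :=
  exists a : nat -> C, forall k, p k = \sum_(i < n.+1) a i * (rising i k)%:R.

Lemma rising_spanW n m p : (n <= m)%N -> rising_span n p -> rising_span m p.
Proof.
move=> nm [a ap]; exists (fun i => if (i <= n)%N then a i else 0) => k.
rewrite ap [RHS](@sum_ord_trunc _ n.+1 m.+1
  (fun i => (if (i <= n)%N then a i else 0) * (rising i k)%:R)) //.
  by apply: eq_bigr => i _; rewrite -ltnS ltn_ord.
by move=> i /andP[ni _]; rewrite leqNgt ni mul0r.
Qed.

Lemma rising_spanP n (b : C) p q : rising_span n p -> rising_span n q ->
  rising_span n (fun k => b * p k + q k).
Proof.
move=> [a ap] [a' aq]; exists (fun i => b * a i + a' i) => k.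
rewrite ap aq mulr_sumr -big_split /=; apply: eq_bigr => i _.
by rewrite mulrDl mulrA.
Qed.

Lemma rising_span0 n : rising_span n (fun=> 0).
Proof. by exists (fun=> 0) => k; rewrite big1 // => i _; rewrite mul0r. Qed.

Lemma rising_span_sum n (I : Type) (r : seq I) (b : I -> C) (p : I -> nat -> C) :
  (forall i, rising_span n (p i)) ->
  rising_span n (fun k => \sum_(i <- r) b i * p i k).
Proof.
move=> np; elim: r => [|i r IH].
  by under eq_fun do rewrite big_nil; exact: rising_span0.
by under eq_fun do rewrite big_cons; exact: rising_spanP.
Qed.

Lemma rising_span_basis i : rising_span i (fun k => (rising i k)%:R).
Proof.
exists (fun j => (j == i)%:R) => k; rewrite big_ord_recr /= eqxx mul1r big1 ?add0r //.
by move=> j _; rewrite ltn_eqF ?mul0r.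
Qed.

Lemma rising_span_shift n p : rising_span n p -> rising_span n (fun k => p k.+1).
Proof.
have base i : rising_span i (fun k => (rising i k.+1)%:R).
  elim: i => [|i IH]; first exact: (rising_span_basis 0).
  under eq_fun do rewrite rising_shift natrD natrM addrC.
  by apply: rising_spanP; [exact: rising_spanW IH|exact: rising_span_basis].
move=> [a ap]; under eq_fun do rewrite ap.
under eq_fun do rewrite -(big_mkord xpredT (fun i => a i * (rising i _.+1)%:R)).
(* The [if] leaves the sum unchanged and puts the summand in the span for every index, as
   [rising_span_sum] asks. *)
rewrite (_ : (fun k => _) = fun k => \sum_(0 <= i < n.+1) a i *
  (if (i <= n)%N then (rising i k.+1)%:R else 0)); last first.
  by apply/funext => k; apply: eq_big_nat => i /andP[_]; rewrite ltnS => ->.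
apply: rising_span_sum => i; case: leqP => [ni|_]; first exact: rising_spanW (base i).
exact: rising_span0.
Qed.

Lemma rising_span_mulS n p : rising_span n p ->
  rising_span n.+1 (fun k => k.+1%:R * p k.+1).
Proof.
move=> [a ap]; exists (fun i => if i is j.+1 then a j else 0) => k.
rewrite ap mulr_sumr [RHS]big_ord_recl mul0r add0r; apply: eq_bigr => i _.
by rewrite lift0 /= natrM mulrCA.
Qed.

Lemma rising_span_qcoef w : rising_span (size w) (fun k => (qcoef w k.+1)%:R).
Proof.
elim: w => [|j w IH]; first exact: (rising_span_basis 0).
have IHj : rising_span (size w) (fun k => (qcoef w (k + j).+1)%:R).
  elim: j => [|j IHj]; first by under eq_fun do rewrite addn0.
  by under eq_fun do rewrite -addSnnS; exact: (rising_span_shift IHj).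
have /rising_span_mulS := IHj; congr (rising_span _ _); apply/funext => k.
by rewrite -natrM /= addSn addnS.
Qed.

(** A word of weight [n] has at most [n] letters, each contributing one linear factor. This degree
    bound is what places [psi f n] in [operP n]. *)
Lemma rising_span_mu f n : rising_span n (fun k => mu f n k.+1).
Proof.
rewrite /mu; under eq_fun do rewrite big_seq_cond big_mkcondr /=.
rewrite (_ : (fun k => _) = fun k => \sum_(w <- words n) f w *
   (if (size w <= n)%N then (qcoef w k.+1)%:R else 0)).
  apply: rising_span_sum => w; case: leqP => [wn|_]; last exact: rising_span0.
  exact: rising_spanW (rising_span_qcoef w).
apply/funext => k; rewrite -big_seq big_seq [RHS]big_seq; apply: eq_bigr => w.
by rewrite mem_words => /eqP <-; rewrite size_weight.
Qed.

(** An explicit [Psi]: an operator of degree n in D and L sends u to the sequence u_(k+n) times a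
    factor depending on k. The index [k.+1] reflects the pairing of z^k with r^(k+1). *)
Definition psi f : opseries R := fun n u k => mu f n k.+1 * u (k + n)%N.

Lemma psi_linA c : psi (linA c) = linS c.
Proof.
apply/funext => -[|n]; apply/funext => u; apply/funext => k.
  by rewrite /psi mu0 mul0r.
by rewrite /psi mu_linA /linS fpseriesZ /opD iter_opL mulrCA mulrA addSnnS.
Qed.

Lemma linS_inj c c' : linS c = linS c' -> c = c'.
Proof.
rewrite -!psi_linA => E; apply/funext => n.
have := congr1 (fun F : opseries R => F n.+1 (fun=> 1) 0%N) E.
by rewrite /psi !mu_linA !mulr1 !mul1r.
Qed.

Lemma psi_inj f g : psi f = psi g -> forall n k, mu f n k.+1 = mu g n k.+1.
Proof.
move=> E n k; have := congr1 (fun F : opseries R => F n (fun=> 1) k) E.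
by rewrite /psi !mulr1.
Qed.

Lemma eq_psi f g : (forall n k, mu f n k.+1 = mu g n k.+1) -> psi f = psi g.
Proof.
move=> E; apply/funext => n; apply/funext => u; apply/funext => k.
by rewrite /psi E.
Qed.

Lemma psi_mulNC f g : psi (mulNC f g) = mulS (psi f) (psi g).
Proof.
apply/funext => n; apply/funext => u; apply/funext => k.
rewrite /psi mu_mulNC mulr_suml /mulS fpseries_sum; apply: eq_bigr => a _.
rewrite addSn mulrA; congr (_ * u _).
by rewrite -addnA subnKC // -ltnS.
Qed.

Lemma psi_oneA : psi (oneA R) = @oneS R.
Proof.
apply/funext => n; apply/funext => u; apply/funext => k; rewrite /psi /oneS.
case: n => [|n]; first by rewrite mu0 mul1r addn0.
rewrite muS big1 ?mul0r // => j _; rewrite /mu big1 ?mulr0 // => w _.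
by rewrite /lder /oneA mul0r.
Qed.

Lemma psi_continuous : continuous psi.
Proof.
apply: ptws_continuousP => n; apply: ptws_continuousP => u.
by apply: ptws_continuousP => k; apply: cplxZr_continuous; exact: mu_continuous.
Qed.

Lemma operP_psi f n : operP n (psi f n).
Proof.
have [a ap] := rising_span_mu f n.
(* In degree 0 the only coefficient is that of the identity, which [operP] keeps apart. *)
exists (if n == 0%N then a 0%N else 0), (fun i k => if k == n then a i else 0) => u.
apply/funext => k; rewrite fpseriesD fpseriesZ /psi ap.
case: n {f ap} => [|n].
  by rewrite big_geq // addr0 big_ord1 /= mulr1 addn0.
rewrite mul0r add0r big_nat_recr //= eqxx fpseriesD fpseries_sum.
rewrite [X in _ = X + _]big_nat [X in _ = X + _]big1 ?add0r => [|m /andP[_ mn]].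
  2: by rewrite fpseries_sum big1 // => i _; rewrite ltn_eqF // scale0r.
rewrite mulr_suml fpseries_sum; apply: eq_bigr => i _.
rewrite fpseriesZ iter_opD_opL mulrA; congr (_ * u _).
by rewrite -addnA subnKC // -ltnS.
Qed.

Lemma genA_linA j : genA R j = linA (fun i => (i == j)%:R).
Proof. by apply/funext => -[|i [|k w]]; rewrite /genA ?eqseq_cons ?andbT ?andbF. Qed.

Lemma is_Psi_psi : is_Psi psi.
Proof.
split.
- by split; [move=> f n; exact: operP_psi|exact: psi_continuous].
- move=> a f g; apply/funext => n; apply/funext => u; apply/funext => k.
  by rewrite [LHS]/psi muP mulrDl -mulrA.
- exact: psi_mulNC.
- exact: psi_oneA.
- by move=> j; rewrite genA_linA psi_linA.
Qed.

Definition monomial w : ncseries R := foldr (fun j f => mulNC (genA R j) f) (oneA R) w.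

Lemma monomialE w (v : word) : monomial w v = (v == w)%:R.
Proof.
elim: w v => [|j w IH] [|i v] //=; rewrite genA_linA ?mulNC_nil ?mul0r //.
by rewrite mulNC_lin_cons IH eqseq_cons -natrM mulnb.
Qed.

Definition truncation f N : ncseries R :=
  \sum_(n < N) \sum_(w <- words n) f w *: monomial w.

Lemma truncationE f N (v : word) : truncation f N v = if (weight v < N)%N then f v else 0.
Proof.
rewrite /truncation ncseries_sum; under eq_bigr do rewrite ncseries_sum.
have E n : \sum_(w <- words n) (f w *: monomial w) v = if weight v == n then f v else 0.
  rewrite -mem_words; case: ifPn => vn.
    rewrite (bigD1_seq v) ?uniq_words //= ncseriesZ monomialE eqxx mulr1 big1 ?addr0 //.
    by move=> w wv; rewrite ncseriesZ monomialE eq_sym (negPf wv) mulr0.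
  rewrite big_seq big1 // => w wn; rewrite ncseriesZ monomialE.
  by case: eqVneq vn => [->|_ _]; rewrite ?wn ?mulr0.
under eq_bigr do rewrite E.
case: ltnP => vN.
  rewrite (bigD1 (Ordinal vN)) //= eqxx big1 ?addr0 // => n.
  by rewrite -val_eqE eq_sym /= => /negPf ->.
by rewrite big1 // => n _; rewrite gtn_eqF // (leq_trans (ltn_ord n)).
Qed.

Lemma truncation_cvg f : truncation f @ \oo --> f.
Proof.
apply: ptws_cvgP => w.
apply: (@cvg_near_cst _ _ (f w) (fun N => truncation f N w)).
by exists (weight w).+1 => //= N wN; rewrite truncationE wN.
Qed.

(** The properties in [is_Psi] have a unique solution: they determine it on monomials, then on
    truncations, and truncations of [f] converge to [f]. *)
Lemma PsiE : @Psi R = psi.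
Proof.
have : is_Psi (@Psi R) by apply: getPex; exists psi; exact: is_Psi_psi.
move: (@Psi R) => P [[_ cP] linP mulP oneP genP].
have P0 : P 0 = 0.
  have := linP 1 0 0; rewrite !scale1r addr0 => /eqP.
  by rewrite -subr_eq0 opprD addrA subrr add0r oppr_eq0 => /eqP.
have psi0 : psi 0 = 0.
  apply/funext => n; apply/funext => u; apply/funext => k.
  by rewrite /psi /mu big1 ?mul0r // => w _; rewrite mul0r.
have linpsi : forall a f g, psi (a *: f + g) = a *: psi f + psi g.
  by case: is_Psi_psi.
have mono w : P (monomial w) = psi (monomial w).
  elim: w => [|j w IH] /=; first by rewrite oneP psi_oneA.
  by rewrite mulP psi_mulNC IH genP genA_linA psi_linA.
have trunc f N : P (truncation f N) = psi (truncation f N).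
  have addP g h : P (g + h) = P g + P h by have := linP 1 g h; rewrite !scale1r.
  have addpsi g h : psi (g + h) = psi g + psi h.
    by have := linpsi 1 g h; rewrite !scale1r.
  rewrite /truncation.
  apply: (big_ind (fun g => P g = psi g)); first by rewrite P0 psi0.
    by move=> g h Pg Ph; rewrite addP addpsi Pg Ph.
  move=> n _; elim: (words n) => [|w r IH]; first by rewrite big_nil P0 psi0.
  by rewrite big_cons linP linpsi mono IH.
apply/funext => f; apply/funext => n; apply/funext => u; apply/funext => k.
have cE (Q : ncseries R -> opseries R) : continuous Q ->
    continuous (fun f => Q f n u k).
  move=> cQ g.
  apply: (@continuous_comp _ _ _ Q (fun F : opseries R => F n u k)); first exact: cQ.
  apply: (@continuous_comp _ _ _ (fun F : opseries R => F n) (fun F : oper R => F u k)).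
    exact: ptws_eval_continuous.
  apply: (@continuous_comp _ _ _ (fun F : oper R => F u) (fun F : fpseries R => F k));
  exact: ptws_eval_continuous.
apply: (eq_on_closureT cplx_hausdorff (cE _ cP) (cE _ psi_continuous)
  (A := range (truncation f))).
  by move=> _ /set_mem[N _ <-]; rewrite trunc.
by apply: (closure_cvg _ (@truncation_cvg f)) => N; exists N.
Qed.

End PsiConstruction.

(** * Injectivity and surjectivity of the exponential maps *)

Section Exponential.
Variable R : realType.
Notation C := (cplx R).
Implicit Types (f g h : ncseries R) (u v : fpseries R) (w : word) (c : nat -> C).

(** The terms of exponent at least two. On words of length n + 1 they see [f] only up to length n
    ([high_exp_eq]), which makes [expA] triangular. *)
Definition high_exp f w : C :=
  \sum_(k < (size w).-1) (k.+2`!%:R)^-1 * expnA f k.+2 w.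

Lemma expA_high f w : f [::] = 0 -> expA f w = oneA R w + f w + high_exp f w.
Proof.
move=> f0; case: w => [|j w].
  by rewrite expA_nil f0 /high_exp big_ord0 !addr0.
rewrite /expA 2!big_ord_recl /= !invr1 !mul1r addrA /high_exp; congr (_ + _ + _).
by rewrite /expnA /= mulNC1.
Qed.

Lemma high_exp_eq f g n w : f [::] = 0 -> g [::] = 0 ->
  (forall v : word, (size v <= n)%N -> f v = g v) -> (size w <= n.+1)%N ->
  high_exp f w = high_exp g w.
Proof.
move=> f0 g0 fg wn; apply: eq_bigr => k _.
by rewrite (expnA_eq f0 g0 fg).
Qed.

Lemma expA_inj : {in lieG (R:=R) &, injective (@expA R)}.
Proof.
move=> f g /set_mem f0 /set_mem g0 E.
have fg n : forall w, (size w <= n)%N -> f w = g w.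
  elim: n => [|n IH] w wn; first by case: w wn => // _; rewrite f0 g0.
  have := congr1 (fun h : ncseries R => h w) E.
  by rewrite /= !expA_high // (high_exp_eq f0 g0 IH) // => /addIr/addrI.
by apply/funext => w; apply: (fg (size w)).
Qed.

Lemma expA_surj g : g [::] = 1 -> exists2 f, f [::] = 0 & expA f = g.
Proof.
move=> g1; pose nz f : ncseries R := fun w => if w is [::] then 0 else f w.
pose K f : ncseries R := fun w => g w - oneA R w - high_exp (nz f) w.
have KE : rank_fix size K = K (rank_fix size K).
  apply: rank_fixE => f f' w ff'; congr (_ - _).
  case: w ff' => [|j w] ff'; first by rewrite /high_exp !big_ord0.
  by apply: (@high_exp_eq _ _ (size w)) => // -[|i v] //= vw; exact: ff'.
set f := rank_fix size K in KE.
have f0 : f [::] = 0 by rewrite KE /K /high_exp big_ord0 g1 subrr subr0.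
have nzf : nz f = f by apply/funext => -[|i w].
exists f => //; apply/funext => w; rewrite expA_high // {1}KE /K nzf; ring.
Qed.

Lemma logAK g : g [::] = 1 -> logA g [::] = 0 /\ expA (logA g) = g.
Proof.
move=> /expA_surj[f f0 <-]; rewrite /logA pinvKV ?inE //; exact: expA_inj.
Qed.

Lemma psi_expnA f k : psi (expnA f k) = Defs.expnS (psi f) k.
Proof. by elim: k => [|k IH]; rewrite ?psi_oneA //= psi_mulNC IH. Qed.

Lemma psi_expA f : f [::] = 0 -> psi (expA f) = expS (psi f).
Proof.
move=> f0; apply/funext => n; apply/funext => u; apply/funext => k.
rewrite /expS fpseries_sum {1}/psi mu_expA // mulr_suml.
by apply: eq_bigr => i _; rewrite fpseriesZ -psi_expnA /psi mulrA.
Qed.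

(** The same triangularity as for [expA], with weight in place of length: the part of weight n of a
    power with exponent at least two involves only lower weights. *)
Lemma expS_psi_inj f g : f [::] = 0 -> g [::] = 0 ->
  expS (psi f) = expS (psi g) -> psi f = psi g.
Proof.
move=> f0 g0; rewrite -!psi_expA // => /psi_inj E.
suff fg n : forall m k, (m < n)%N -> mu f m k.+1 = mu g m k.+1.
  by apply: eq_psi => n k; apply: (fg n.+1).
elim: n => // n IH m k; rewrite ltnS leq_eqVlt => /orP[/eqP ->|]; last exact: IH.
have agree i m' l : (m' < n)%N -> mu (expnA f i) m' l.+1 = mu (expnA g i) m' l.+1.
  elim: i m' l => // i IHi m' l mn; rewrite !expnAS !mu_mulNC; apply: eq_bigr => a _.
  rewrite addSn IH ?IHi //; first by rewrite (leq_ltn_trans (leq_subr _ _)).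
  by rewrite (leq_ltn_trans _ mn) // -ltnS.
have agree2 i : mu (expnA f i.+2) n k.+1 = mu (expnA g i.+2) n k.+1.
  rewrite !(expnAS _ i.+1) !mu_mulNC; apply: eq_bigr => a _.
  have [a0|a0] := posnP a; first by rewrite a0 !mu0 f0 g0 !mul0r.
  have an : (a <= n)%N by rewrite -ltnS.
  (* For a = n the other factor is the constant term of a positive power, hence 0. *)
  have [->|an'] := eqVneq (a : nat) n; last first.
    by rewrite addSn IH ?agree //; lia.
  by rewrite subnn !mu0 !expnAS !mulNC_nil f0 g0 !mul0r !mulr0.
move: (E n k); rewrite !mu_expA //; case: n {E IH agree} agree2 => [|n] agree2.
  by rewrite !mu0 f0 g0.
rewrite !big_ord_recl.
under [X in _ + (_ + X) = _ -> _]eq_bigr do rewrite !lift0 agree2.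
by move/addrI/addIr; rewrite invr1 !mul1r /expnA /= !mulNC1.
Qed.

End Exponential.

(** * Integrals of bounded measurable complex functions *)

Section Integration.
Variable R : realType.
Notation C := (cplx R).
Notation N := (@ComplexField.Normc.normc R).
Notation Re := (@complex.Re R).
Notation Im := (@complex.Im R).
Notation mu := (@lebesgue_measure R).
Implicit Types (f g : R -> C) (x y s T M : R).

Lemma norm_normc (z : C) : `|z| = (N z)%:C%C. Proof. by []. Qed.

Lemma cplx_normc_ge0 (z : C) : 0 <= N z.
Proof. by rewrite -lecR -norm_normc normr_ge0. Qed.

Lemma cplx_normcD (z z' : C) : N (z + z') <= N z + N z'.
Proof. exact: le_normcD. Qed.

Lemma cplx_normcN (z : C) : N (- z) = N z.
Proof. exact: normcN. Qed.

Lemma cplx_normc0 : N (0 : C) = 0.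
Proof. exact: ComplexField.Normc.normc0. Qed.

Lemma cplx_normcM (z z' : C) : N (z * z') = N z * N z'.
Proof. exact: ComplexField.Normc.normcM. Qed.

Lemma cplx_normc_sum I (r : seq I) (P : pred I) (F : I -> C) :
  N (\sum_(i <- r | P i) F i) <= \sum_(i <- r | P i) N (F i).
Proof.
elim/big_rec2: _ => [|i y z _ le]; first by rewrite cplx_normc0.
by apply: le_trans (cplx_normcD _ _) _; rewrite lerD2l.
Qed.

Lemma cplx_normc_le (z : C) : N z <= `|Re z| + `|Im z|.
Proof.
case: z => a b /=; rewrite -(@ler_pXn2r _ 2%N) ?nnegrE ?sqrtr_ge0 ?addr_ge0 //.
rewrite sqr_sqrtr ?addr_ge0 ?sqr_ge0 // sqrrD !real_normK ?num_real // lerD2r.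
by rewrite lerDl mulrn_wge0 ?mulr_ge0.
Qed.

Lemma Re_le_normc (z : C) : `|Re z| <= N z.
Proof. by have := normc_ge_Re z; rewrite norm_normc lecR. Qed.

Lemma Im_le_normc (z : C) : `|Im z| <= N z.
Proof.
case: z => a b /=; rewrite -sqrtr_sqr ler_wsqrtr // lerDr sqr_ge0 //.
Qed.

Lemma cplx_cvg (u : nat -> C) (l : C) (K : R) :
  (forall m, N (u m - l) <= K / m.+1%:R) -> u @ \oo --> l.
Proof.
move=> uK; apply/(@cvgrPdist_lt C C) => e e0.
(* In the order of the complex numbers a positive [e] is real. *)
have [Im0 Re0] : Im e = 0 /\ 0 < Re e.
  by move: e0; rewrite ltcE /= => /andP[/eqP].
have -> : e = (Re e)%:C%C by case: e Im0 {e0 Re0} => a b /= ->.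
have K0 : 0 < `|K| + 1 by rewrite ltr_wpDl.
pose d := PosNum (divr_gt0 Re0 K0).
have [m0 _ m0P] := @near_infty_natSinv_lt R d.
exists m0 => // m /m0P; rewrite /= norm_normc ltcR -cplx_normcN opprB => md.
apply: le_lt_trans (uK m) _.
apply: le_lt_trans (_ : (`|K| + 1) / m.+1%:R < _).
  by rewrite ler_wpM2r ?invr_ge0 // (le_trans (ler_norm _)) // lerDl.
by rewrite mulrC -ltr_pdivlMr.
Qed.

Lemma cplx_eq_from_bound (z l : C) (K : R) :
  (forall m, N (z - l) <= K / m.+1%:R) -> z = l.
Proof.
move=> zK; have := @cplx_cvg (fun=> z) l K zK.
by move/(cvg_unique (@cplx_hausdorff R) (cvg_cst z)).
Qed.

Definition bounded_measurable T f : Prop :=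
  [/\ measurable_fun `[0, T] (Re \o f), measurable_fun `[0, T] (Im \o f) &
      exists M, forall x, x \in `[0, T] -> N (f x) <= M].

Lemma itv0T x s T : x <= T -> s \in `[0, x] -> s \in `[0, T].
Proof. by rewrite !in_itv /= => xT /andP[-> /le_trans ->]. Qed.

Lemma bounded_measurable_integrable T f x : bounded_measurable T f -> x <= T ->
  mu.-integrable `[0, x] (EFin \o (Re \o f)) /\
  mu.-integrable `[0, x] (EFin \o (Im \o f)).
Proof.
move=> [mRe mIm [M fM]] xT.
have sub : `[0, x] `<=` `[0, T] by move=> s /(itv0T xT).
have fin : let m := mu `[0, x] in (m < +oo)%E.
  by rewrite lebesgue_measure_itv; case: ifP => //= _; rewrite -EFinB ltry.
split; apply: measurable_bounded_integrable => //.
- exact: measurable_funS mRe.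
- exists M; split; rewrite ?num_real // => y My s /= /sub sx.
  by rewrite (le_trans (Re_le_normc _)) // (le_trans (fM _ sx)) // ltW.
- exact: measurable_funS mIm.
- exists M; split; rewrite ?num_real // => y My s /= /sub sx.
  by rewrite (le_trans (Im_le_normc _)) // (le_trans (fM _ sx)) // ltW.
Qed.

Lemma bounded_measurableD T f g : bounded_measurable T f ->
  bounded_measurable T g -> bounded_measurable T (fun x => f x + g x).
Proof.
move=> [fR fI [M fM]] [gR gI [M' gM]]; split.
- rewrite (_ : _ \o _ = (Re \o f) \+ (Re \o g)); first exact: measurable_funD.
  by apply/funext => x /=; case: (f x) (g x) => [a b] [a' b'].
- rewrite (_ : _ \o _ = (Im \o f) \+ (Im \o g)); first exact: measurable_funD.
  by apply/funext => x /=; case: (f x) (g x) => [a b] [a' b'].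
- exists (M + M') => x xT; apply: le_trans (cplx_normcD _ _) _.
  by rewrite lerD ?fM ?gM.
Qed.

Lemma bounded_measurableM T f g : bounded_measurable T f ->
  bounded_measurable T g -> bounded_measurable T (fun x => f x * g x).
Proof.
move=> [fR fI [M fM]] [gR gI [M' gM]]; split.
- rewrite (_ : _ \o _ = (Re \o f) \* (Re \o g) \- (Im \o f) \* (Im \o g)).
    by apply: measurable_funB; exact: measurable_funM.
  by apply/funext => x /=; case: (f x) (g x) => [a b] [a' b'].
- rewrite (_ : _ \o _ = (Re \o f) \* (Im \o g) \+ (Im \o f) \* (Re \o g)).
    by apply: measurable_funD; exact: measurable_funM.
  by apply/funext => x /=; case: (f x) (g x) => [a b] [a' b'].
- exists (M * M') => x xT; rewrite cplx_normcM ler_pM ?cplx_normc_ge0 ?fM ?gM //.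
Qed.

Lemma bounded_measurable_cst T (z : C) : bounded_measurable T (fun=> z).
Proof.
split; first exact: (@measurable_cst _ _ _ _ _ (Re z)).
  exact: (@measurable_cst _ _ _ _ _ (Im z)).
by exists (N z).
Qed.

Lemma cintegral_ext f g x : (forall s, s \in `[0, x] -> f s = g s) ->
  cintegral f x = cintegral g x.
Proof.
move=> fg; rewrite /cintegral.
congr Complex; apply: eq_Rintegral => s /set_mem /= sx; by rewrite fg.
Qed.

Lemma cintegral0 f : cintegral f 0 = 0.
Proof. by rewrite /cintegral set_itv1 !Rintegral_set1. Qed.

Lemma cintegralD T f g x : bounded_measurable T f -> bounded_measurable T g ->
  x <= T -> cintegral (fun s => f s + g s) x = cintegral f x + cintegral g x.
Proof.
move=> fT gT xT; have [fR fI] := bounded_measurable_integrable fT xT.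
have [gR gI] := bounded_measurable_integrable gT xT.
rewrite /cintegral [RHS]/GRing.add /=; congr Complex.
  rewrite -RintegralD //; apply: eq_Rintegral => s _.
  by case: (f s) (g s) => [a b] [a' b'].
rewrite -RintegralD //; apply: eq_Rintegral => s _.
by case: (f s) (g s) => [a b] [a' b'].
Qed.

Lemma cintegralZ T f (z : C) x : bounded_measurable T f -> x <= T ->
  cintegral (fun s => z * f s) x = z * cintegral f x.
Proof.
move=> fT xT; have [fR fI] := bounded_measurable_integrable fT xT.
have RZ (a : R) h : mu.-integrable `[0, x] (EFin \o h) ->
    mu.-integrable `[0, x] (EFin \o (fun s => a * h s)).
  by move=> ih; exact: (integrableZl _ a ih).
case: z => a b; rewrite /cintegral [RHS]/GRing.mul /=; congr Complex.
  rewrite -!RintegralZl // -RintegralB //; try exact: RZ.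
  by apply: eq_Rintegral => s _ /=; case: (f s) => [a' b'].
rewrite -!RintegralZl // -RintegralD //; try exact: RZ.
by apply: eq_Rintegral => s _ /=; case: (f s) => [a' b'].
Qed.

Lemma Rintegral_increment (h : R -> R) x y M :
  mu.-integrable `[0, y] (EFin \o h) -> 0 <= x -> x <= y ->
  (forall s, x < s -> s <= y -> `|h s| <= M) ->
  `|\int[mu]_(s in `[0, y]) h s - \int[mu]_(s in `[0, x]) h s| <= M * (y - x).
Proof.
move=> hi x0 xy hM; rewrite Rintegral_itvB ?bnd_simp //.
have sub : `]x, y] `<=` `[0, y].
  by move=> s; rewrite /= !in_itv /= => /andP[xs ->]; rewrite andbT (le_trans x0) // ltW.
have hi' : mu.-integrable `]x, y] (EFin \o h) by exact: integrableS hi.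
have muxy : mu `]x, y] = (y - x)%:E.
  rewrite lebesgue_measure_itv /= lte_fin; case: ltgtP xy => //= -> _.
  by rewrite subrr.
apply: le_trans (le_normr_Rintegral _ hi') _ => //.
have -> : M * (y - x) = \int[mu]_(s in `]x, y]) M.
  by rewrite Rintegral_cst //= muxy.
apply: le_Rintegral => //.
- exact: (integrable_norm hi').
- apply: measurable_bounded_integrable => //.
    by apply: (@le_lt_trans _ _ (mu `]x, y])) => //; rewrite muxy ltry.
  exists `|M|; split; rewrite ?num_real // => z Mz s _ /=; exact: ltW.
- by move=> s; rewrite /= in_itv /= => /andP[xs sy]; exact: hM.
Qed.

(** The factor 2 comes from bounding real and imaginary parts separately. The bound is asked on the
    half-open interval only, which suits step functions. *)
Lemma cintegral_increment T f x y M : bounded_measurable T f ->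
  0 <= x -> x <= y -> y <= T -> (forall s, x < s -> s <= y -> N (f s) <= M) ->
  N (cintegral f y - cintegral f x) <= 2 * M * (y - x).
Proof.
move=> fT x0 xy yT fM; have [fR fI] := bounded_measurable_integrable fT yT.
apply: le_trans (cplx_normc_le _) _; rewrite -mulrA mulr_natl mulr2n.
apply: lerD; apply: Rintegral_increment => // s xs sy.
  exact: le_trans (Re_le_normc _) (fM _ xs sy).
exact: le_trans (Im_le_normc _) (fM _ xs sy).
Qed.

Lemma bounded_measurable_cintegral T f : 0 <= T -> bounded_measurable T f ->
  bounded_measurable T (cintegral f).
Proof.
move=> T0 fT; have [fR fI] := bounded_measurable_integrable fT (lexx T).
split.
- apply: subspace_continuous_measurable_fun => //.
  exact: (parameterized_integral_continuous T0 fR).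
- apply: subspace_continuous_measurable_fun => //.
  exact: (parameterized_integral_continuous T0 fI).
- have [_ _ [M fM]] := fT; exists (2 * `|M| * T) => x.
  rewrite in_itv /= => /andP[x0 xT].
  have := @cintegral_increment T f 0 x `|M| fT (lexx _) x0 xT.
  rewrite cintegral0 !subr0 => le; apply: le_trans (le _) _.
    move=> s s0 sx; apply: le_trans (ler_norm _); apply: fM.
    by rewrite in_itv /= (ltW s0) (le_trans sx).
  by rewrite ler_wpM2l // mulr_ge0.
Qed.

Lemma cintegral_Lipschitz T f : bounded_measurable T f -> exists2 K, 0 <= K &
  forall x y, 0 <= x -> x <= y -> y <= T ->
    N (cintegral f y - cintegral f x) <= K * (y - x).
Proof.
move=> fT; have [_ _ [M fM]] := fT; exists (2 * `|M|) => [|x y x0 xy yT].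
  by rewrite mulr_ge0.
apply: (cintegral_increment fT) => // s xs sy; apply: le_trans (ler_norm _).
by apply: fM; rewrite in_itv /= (le_trans sy) // andbT (le_trans x0) // ltW.
Qed.

Lemma cintegral_cst (z : C) x : 0 <= x -> cintegral (fun=> z) x = z * x%:C%C.
Proof.
move=> x0; rewrite /cintegral !Rintegral_cst //= lebesgue_measure_itv /= lte_fin.
have -> : fine (if (0 < x)%R then x%:E - 0%:E else 0)%E = x.
  by case: ltgtP x0 => //= x0' _; rewrite subr0.
by case: z => a b; rewrite [RHS]/GRing.mul /= !mulr0 subr0 add0r mulrC [b * _]mulrC.
Qed.

End Integration.

(** * Paths as limits of products of exponentials *)

Section Paths.
Variable R : realType.
Notation C := (cplx R).
Notation N := (@ComplexField.Normc.normc R).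
Implicit Types (a : nat -> R -> C) (w : word) (x y s T : R) (c : nat -> C).

Lemma pathX_bounded_measurable T a j : pathX T a -> bounded_measurable T (a j).
Proof.
move=> [am [M aM]]; have [aR aI] := am j; split => //.
exists (`|M| `^ j.+1%:R) => x xT.
have E : (N (a j x) `^ j.+1%:R^-1) `^ j.+1%:R = N (a j x).
  by rewrite -powRrM mulVf ?pnatr_eq0 // powRr1 // cplx_normc_ge0.
rewrite -E ge0_ler_powR ?nnegrE ?powR_ge0 //.
exact: le_trans (aM _ _ xT) (ler_norm _).
Qed.

Lemma iter_int_rev_bounded_measurable T a w : 0 <= T -> pathX T a ->
  bounded_measurable T (iter_int_rev a w).
Proof.
move=> T0 aX; elim: w => [|j w IH] /=; first exact: bounded_measurable_cst.
apply: bounded_measurable_cintegral => //; apply: bounded_measurableM => //.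
exact: pathX_bounded_measurable.
Qed.

(** The equation at [j :: w] involves only the coefficient at [w], so the leftmost letter is
    integrated last. The same triangularity gives uniqueness below. *)
Lemma is_solution_iter_int T a : is_solution T a (fun x w => iter_int_rev a w x).
Proof.
move=> x xT [|j w] /=.
  rewrite (@cintegral_ext _ _ (fun=> 0)); last by move=> s _; rewrite mulNC_nil mul0r.
  rewrite /oneA cintegral_cst ?mul0r ?addr0 //.
  by move: xT; rewrite in_itv /= => /andP[].
rewrite add0r; apply: cintegral_ext => s _.
by rewrite mulNC_lin_cons.
Qed.

Lemma is_solution_unique T a (F : R -> ncseries R) : is_solution T a F ->
  forall w x, x \in `[0, T] -> F x w = iter_int_rev a w x.
Proof.
move=> FS; elim=> [|j w IH] x xT; rewrite FS // (is_solution_iter_int a xT);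
  congr (_ + _); apply: cintegral_ext => s sx.
  by rewrite !mulNC_nil !mul0r.
rewrite !mulNC_lin_cons IH //; apply: itv0T sx.
by move: xT; rewrite in_itv /= => /andP[].
Qed.

Lemma pathEE T a w : 0 <= T -> pathE T a w = iter_int_rev a w T.
Proof.
move=> T0; apply: (@is_solution_unique T).
  by apply: getPex; exists (fun x w => iter_int_rev a w x); exact: is_solution_iter_int.
by rewrite in_itv /= T0 lexx.
Qed.

(** Later factors stand on the left, as for the solution of F' = A F. *)
Fixpoint exp_prod (h : nat -> nat -> C) (i : nat) : ncseries R :=
  if i is i'.+1 then mulNC (expA (linA (h i'))) (exp_prod h i') else oneA R.

(** Integrals over a step replace values at a node, since the a_j are merely measurable. *)
Definition increments T a (n i j : nat) : C :=
  cintegral (a j) (T * i.+1%:R / n%:R) - cintegral (a j) (T * i%:R / n%:R).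

Lemma exp_prod_nil h i : exp_prod h i [::] = 1.
Proof. by elim: i => //= i IH; rewrite mulNC_nil expA_nil IH mulr1. Qed.

Lemma cplx_normc_nat n : N (n%:R : C) = n%:R.
Proof. by rewrite normcMn ComplexField.Normc.normc1. Qed.

Lemma normc_wprod c w (eta : R) : (forall l, l \in w -> N (c l) <= eta) ->
  N (wprod c w) <= eta ^+ size w.
Proof.
rewrite /wprod; elim: w => [|l w IH] cw.
  by rewrite big_nil ComplexField.Normc.normc1.
rewrite big_cons cplx_normcM exprS ler_pM ?cplx_normc_ge0 //.
  by apply: cw; rewrite mem_head.
by apply: IH => l' l'w; apply: cw; rewrite in_cons l'w orbT.
Qed.

(** What remains comes from the prefixes of [j :: w] of length k + 2 at least 2; each contributes at
    most eta^(k+2) B, and eta^k is at most D^(size w). *)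
Lemma exp_step c (P : ncseries R) j w (eta D B : R) : 0 <= eta -> eta <= D ->
  1 <= D -> 0 <= B -> (forall l, l \in j :: w -> N (c l) <= eta) ->
  (forall k, N (P (drop k w)) <= B) ->
  N (mulNC (expA (linA c)) P (j :: w) - P (j :: w) - c j * P w) <=
  (size w)%:R * (eta ^+ 2 * D ^+ size w * B).
Proof.
move=> eta0 etaD D1 B0 ceta PB; rewrite mulNC_cons expA_nil mul1r.
rewrite [P _ + _]addrC addrK /mulNC big_ord_recl take0 drop0 /lder.
rewrite expA_linA /wprod big_seq1 divr1 [c j * _ + _]addrC addrK.
apply: le_trans (cplx_normc_sum _ _ _) _.
rewrite -[X in X%:R * _](card_ord (size w)) mulr_natl -sumr_const.
apply: ler_sum => k _; rewrite lift0 cplx_normcM ler_pM ?cplx_normc_ge0 //.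
rewrite expA_linA cplx_normcM ComplexField.Normc.normcV cplx_normc_nat.
have f1 : 1 <= (size (j :: take k.+1 w))`!%:R :> R by rewrite ler1n fact_gt0.
apply: le_trans (_ : eta ^+ (size (j :: take k.+1 w)) <= _).
  rewrite -[X in _ <= X]mulr1 ler_pM ?cplx_normc_ge0 ?invr_ge0 //.
    apply: normc_wprod => l; rewrite in_cons => /orP[/eqP ->|lw].
      by apply: ceta; rewrite mem_head.
    by apply: ceta; rewrite in_cons (mem_take lw) orbT.
  by rewrite invf_le1 // (lt_le_trans _ f1).
rewrite /= size_takel ?ltn_ord // -[k.+2]add2n exprD ler_wpM2l ?exprn_ge0 //.
apply: le_trans (_ : D ^+ k <= _); first by rewrite lerXn2r ?nnegrE // (le_trans _ D1).
by rewrite ler_weXn2l // ltnW.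
Qed.

Lemma letters_bound T a w : 0 <= T -> pathX T a -> exists2 A, 0 <= A &
  forall j x, j \in w -> x \in `[0, T] -> N (a j x) <= A.
Proof.
move=> T0 aX; elim: w => [|l w [A A0 wA]]; first by exists 0.
have [_ _ [M aM]] := pathX_bounded_measurable l aX.
exists (A + `|M|) => [|j x]; first by rewrite addr_ge0.
rewrite in_cons => /orP[/eqP -> xT|jw xT].
  by rewrite (le_trans (aM _ xT)) // (le_trans (ler_norm _)) // lerDr.
by rewrite (le_trans (wA _ _ jw xT)) // lerDl.
Qed.

Lemma suffix_bound T a w : 0 <= T -> pathX T a -> exists2 B, 0 <= B &
  forall k x, x \in `[0, T] -> N (iter_int_rev a (drop k w) x) <= B.
Proof.
move=> T0 aX; elim: w => [|l w [B B0 wB]].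
  exists 1 => // -[|k] x _; apply: (le_trans (y := N 1)) => //;
  by rewrite ComplexField.Normc.normc1.
have [_ _ [M aM]] := iter_int_rev_bounded_measurable (l :: w) T0 aX.
exists (B + `|M|) => [|[|k] x xT]; first by rewrite addr_ge0.
  by rewrite drop0 (le_trans (aM _ xT)) // (le_trans (ler_norm _)) // lerDr.
by rewrite (le_trans (wB k _ xT)) // lerDl.
Qed.

Lemma iter_int_rev_Lipschitz T a w : 0 <= T -> pathX T a -> exists2 K, 0 <= K &
  forall x y, 0 <= x -> x <= y -> y <= T ->
    N (iter_int_rev a w y - iter_int_rev a w x) <= K * (y - x).
Proof.
move=> T0 aX; case: w => [|j w].
  exists 0 => // x y _ _ _; rewrite mul0r.
  by have -> : iter_int_rev a [::] y - iter_int_rev a [::] x = 0 :> C;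
    rewrite ?cplx_normc0 ?subrr.
apply: cintegral_Lipschitz; apply: bounded_measurableM.
  exact: pathX_bounded_measurable.
exact: iter_int_rev_bounded_measurable.
Qed.

(* Over one step of length T / n, both the solution and the product of
   exponentials change their coefficient at j :: w by the increment of a_j times
   their coefficient at w, up to O(1 / n^2). *)
Lemma euler_estimate T a w : 0 <= T -> pathX T a -> exists2 K, 0 <= K &
  forall k n i, (0 < n)%N -> (i <= n)%N ->
    N (iter_int_rev a (drop k w) (T * i%:R / n%:R) -
       exp_prod (increments T a n) i (drop k w)) <= K * i%:R * n%:R^-1 ^+ 2.
Proof.
(* All suffixes are treated at once because [exp_step] needs a bound on the product at each of
   them. *)
move=> T0 aX; elim: w => [|j w [K K0 IH]].
  by exists 0 => // k n i _ _; rewrite /= exp_prod_nil subrr cplx_normc0 !mul0r.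
have [A A0 aA] := letters_bound (j :: w) T0 aX.
have [B B0 FB] := suffix_bound w T0 aX.
have [L L0 FL] := iter_int_rev_Lipschitz w T0 aX.
pose D := 1 + 2 * A * T.
have AT0 : 0 <= 2 * A * T by rewrite !mulr_ge0.
have D1 : 1 <= D by rewrite lerDl.
(* The three summands account for the variation of the coefficient at [w] within a step ([step1]),
   the error already made at [w] ([step2]) and the higher terms of the exponential ([step3]). *)
pose K' := 2 * A * L * T ^+ 2 + 2 * A * T * K +
           (size w)%:R * ((2 * A * T) ^+ 2 * D ^+ size w * (B + K)).
have D0 : 0 <= D ^+ size w by rewrite exprn_ge0 // (le_trans _ D1).
have K'0 : 0 <= K'.
  by rewrite /K' !addr_ge0 ?mulr_ge0 ?exprn_ge0 ?addr_ge0 // (le_trans _ D1).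
exists (K + K') => [|k n i n0 ilen]; first by rewrite addr_ge0.
set u := n%:R^-1.
have n0' : 0 < n%:R :> R by rewrite ltr0n.
have u0 : 0 < u by rewrite invr_gt0.
have u1 : u <= 1 by rewrite invf_le1 // ler1n.
have iu m : (m <= n)%N -> m%:R * u <= 1.
  by move=> mn; rewrite ler_pdivrMr // mul1r ler_nat.
have mono K1 K2 : K1 <= K2 -> K1 * i%:R * u ^+ 2 <= K2 * i%:R * u ^+ 2.
  move=> K12; apply: ler_wpM2r; first by rewrite exprn_ge0 // ltW.
  exact: ler_wpM2r.
case: k => [|k]; last first.
  apply: le_trans (IH k n i n0 ilen) _.
  by apply: mono; rewrite lerDl.
rewrite drop0; apply: le_trans (_ : K' * i%:R * u ^+ 2 <= _); last first.
  by apply: mono; rewrite lerDr.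
elim: i {mono} ilen => [|i IHi] ilen.
  have -> : T * 0%:R * u = 0 by rewrite mulr0 mul0r.
  rewrite [iter_int_rev _ _ _](_ : _ = 0); last exact: cintegral0.
  rewrite [exp_prod _ _ _](_ : _ = 0) // subr0 cplx_normc0.
  by rewrite mulr_ge0 ?exprn_ge0 ?mulr_ge0 // ltW.
have {}IHi := IHi (ltnW ilen).
set x := T * i%:R / n%:R in IHi *; set y := T * i.+1%:R / n%:R.
have x0 : 0 <= x by rewrite !mulr_ge0 // invr_ge0 ltW.
have xyE : y - x = T * u by rewrite /x /y -natr1 /u; ring.
have xy : x <= y by rewrite -subr_ge0 xyE mulr_ge0 // ltW.
have yT : y <= T by rewrite /y -mulrA ler_piMr // iu.
have inT s : x < s -> s <= y -> s \in `[0, T].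
  by move=> xs sy; rewrite in_itv /= (le_trans sy) // andbT (le_trans x0) // ltW.
have xT : x \in `[0, T] by rewrite in_itv /= x0 (le_trans xy).
set h := increments T a n i.
have hE l : h l = cintegral (a l) y - cintegral (a l) x by [].
have heta l : l \in j :: w -> N (h l) <= 2 * A * T * u.
  move=> lw; rewrite hE; have := @cintegral_increment _ T (a l) x y A.
  rewrite xyE mulrA; apply => //; first exact: pathX_bounded_measurable.
  by move=> s xs sy; apply: aA => //; exact: inT.
set P := exp_prod (increments T a n) i.
have Pbound k : N (P (drop k w)) <= B + K.
  have := IH k n i n0 (ltnW ilen); rewrite -/P -/x => le.
  have -> : P (drop k w) = iter_int_rev a (drop k w) x -
     (iter_int_rev a (drop k w) x - P (drop k w)) by rewrite opprB addrC subrK.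
  apply: le_trans (cplx_normcD _ _) _; rewrite cplx_normcN lerD ?FB //.
  apply: le_trans le _; rewrite -[X in _ <= X]mulr1 -mulrA ler_wpM2l //.
  rewrite expr2 mulrA mulr_ile1 ?mulr_ge0 ?iu //; try exact: ltW.
  exact: ltnW.
have step1 : N (iter_int_rev a (j :: w) y - iter_int_rev a (j :: w) x -
                iter_int_rev a w x * h j) <= 2 * A * L * T ^+ 2 * u ^+ 2.
  (* With the coefficient at [w] frozen at [x], the difference becomes the integral of a function of
     size O(1/n) over a step. *)
  pose g s := a j s * iter_int_rev a w s + - iter_int_rev a w x * a j s.
  have ajT := pathX_bounded_measurable j aX.
  have FwT := iter_int_rev_bounded_measurable w T0 aX.
  have ajF : bounded_measurable T (fun s => a j s * iter_int_rev a w s).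
    exact: bounded_measurableM.
  have Faj : bounded_measurable T (fun s => - iter_int_rev a w x * a j s).
    by apply: bounded_measurableM => //; exact: bounded_measurable_cst.
  have gE z : z <= T -> cintegral g z =
      iter_int_rev a (j :: w) z - iter_int_rev a w x * cintegral (a j) z.
    by move=> zT; rewrite (cintegralD ajF Faj zT) (cintegralZ _ ajT zT) mulNr.
  have -> : iter_int_rev a (j :: w) y - iter_int_rev a (j :: w) x -
      iter_int_rev a w x * h j = cintegral g y - cintegral g x.
    by rewrite hE !gE ?(le_trans xy) //; ring.
  have -> : 2 * A * L * T ^+ 2 * u ^+ 2 = 2 * (A * (L * (T * u))) * (y - x).
    by rewrite xyE; ring.
  apply: (cintegral_increment (bounded_measurableD ajF Faj)) => // s xs sy.
  have -> : a j s * iter_int_rev a w s + - iter_int_rev a w x * a j s =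
      a j s * (iter_int_rev a w s - iter_int_rev a w x) by ring.
  rewrite cplx_normcM ler_pM ?cplx_normc_ge0 //.
    by apply: aA (inT _ xs sy); rewrite mem_head.
  apply: le_trans (FL x s x0 (ltW xs) (le_trans sy yT)) _.
  by rewrite ler_wpM2l // -xyE lerD2r.
have step2 : N (h j * (iter_int_rev a w x - P w)) <= 2 * A * T * K * u ^+ 2.
  have := IH 0%N n i n0 (ltnW ilen); rewrite drop0 -/P -/x => le.
  rewrite cplx_normcM; apply: le_trans (_ : (2 * A * T * u) * (K * i%:R * u ^+ 2) <= _).
    by rewrite ler_pM ?cplx_normc_ge0 ?heta ?mem_head.
  have -> : 2 * A * T * u * (K * i%:R * u ^+ 2) =
    (2 * A * T * K * u ^+ 2) * (i%:R * u) by ring.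
  apply: ler_piMr; last exact: iu (ltnW ilen).
  by rewrite mulr_ge0 ?exprn_ge0 ?(ltW u0) // mulr_ge0.
have step3 := @exp_step h P j w (2 * A * T * u) D (B + K) _ _ D1 _ heta Pbound.
have {}step3 : N (mulNC (expA (linA h)) P (j :: w) - P (j :: w) - h j * P w) <=
    (size w)%:R * ((2 * A * T) ^+ 2 * D ^+ size w * (B + K)) * u ^+ 2.
  apply: le_trans (step3 _ _ _) _.
  - by rewrite mulr_ge0 // ltW.
  - by apply: le_trans (_ : 2 * A * T <= _); rewrite ?ler_piMr // lerDr.
  - by rewrite addr_ge0.
  - by rewrite le_eqVlt; apply/orP; left; apply/eqP; ring.
have -> : iter_int_rev a (j :: w) y - exp_prod (increments T a n) i.+1 (j :: w) =
  (iter_int_rev a (j :: w) x - P (j :: w)) +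
  ((iter_int_rev a (j :: w) y - iter_int_rev a (j :: w) x - iter_int_rev a w x * h j) +
   (h j * (iter_int_rev a w x - P w) -
    (mulNC (expA (linA h)) P (j :: w) - P (j :: w) - h j * P w))).
  by rewrite -[exp_prod _ i.+1]/(mulNC (expA (linA h)) P); ring.
apply: le_trans (cplx_normcD _ _) _.
have -> : K' * i.+1%:R * u ^+ 2 = K' * i%:R * u ^+ 2 + K' * u ^+ 2.
  by rewrite -natr1; ring.
apply: lerD => //; apply: le_trans (cplx_normcD _ _) _.
have -> : K' * u ^+ 2 = 2 * A * L * T ^+ 2 * u ^+ 2 + (2 * A * T * K * u ^+ 2 +
   (size w)%:R * ((2 * A * T) ^+ 2 * D ^+ size w * (B + K)) * u ^+ 2).
  by rewrite /K'; ring.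
apply: lerD => //; apply: le_trans (cplx_normcD _ _) _; rewrite cplx_normcN.
exact: lerD.
Qed.

Lemma euler_limit T a w : 0 <= T -> pathX T a -> exists K, forall n, (0 < n)%N ->
  N (exp_prod (increments T a n) n w - pathE T a w) <= K / n%:R.
Proof.
move=> T0 aX; have [K K0 H] := euler_estimate w T0 aX; exists K => n n0.
have := H 0%N n n n0 (leqnn n); rewrite drop0 pathEE //.
have nn : n%:R != 0 :> R by rewrite pnatr_eq0 -lt0n.
have -> : T * n%:R / n%:R = T by rewrite mulfK.
have -> : K * n%:R * n%:R^-1 ^+ 2 = K / n%:R by field.
by rewrite -cplx_normcN opprB.
Qed.

End Paths.

(** * Subgroups and products of exponentials *)

Section Subgroups.
Variable R : realType.
Notation C := (cplx R).
Implicit Types (f g : ncseries R) (B H : set (ncseries R)) (h c : nat -> nat -> C).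

Lemma is_subgroup_groupG : is_subgroup (groupG (R := R)).
Proof.
split=> //.
  by move=> f g f1 g1; rewrite /groupG /= mulNC_nil f1 g1 mulr1.
move=> f g f1 /(congr1 (fun h : ncseries R => h [::])).
by rewrite mulNC_nil f1 mul1r.
Qed.

Lemma gen_subgroup_sub B : B `<=` gen_subgroup B.
Proof. exact: sub_smallest. Qed.

Lemma gen_subgroup_min B H : is_subgroup H -> B `<=` H -> gen_subgroup B `<=` H.
Proof. by move=> HS BH; exact: smallest_sub. Qed.

Lemma is_subgroup_gen B : B `<=` groupG (R := R) -> is_subgroup (gen_subgroup B).
Proof.
move=> BG; split.
- exact: gen_subgroup_min is_subgroup_groupG BG.
- by move=> H [[_ H1 _ _] _].
- by move=> f g fB gB H HB; have [[_ _ HM _] _] := HB; apply: HM; [exact: fB|exact: gB].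
- move=> f g fB fg gf H HB; have [[_ _ _ HV] _] := HB.
  exact: (HV f g (fB H HB) fg gf).
Qed.

Lemma exp_linL_groupG : @expA R @` linL R `<=` groupG (R := R).
Proof. by move=> _ [_ [d _ <-] <-]; exact: expA_nil. Qed.

Lemma is_subgroup_PL : is_subgroup (PL R).
Proof. exact/is_subgroup_gen/exp_linL_groupG. Qed.

Lemma PL_exp (d : nat -> C) : PL R (expA (linA d)).
Proof. by apply: gen_subgroup_sub; exists (linA d) => //; exists d. Qed.

Lemma exp_prod_eq h c n : (forall i, (i < n)%N -> h i = c i) ->
  exp_prod h n = exp_prod c n.
Proof.
elim: n => //= n IH hc; rewrite hc // IH // => i /ltnW; exact: hc.
Qed.

Lemma exp_prod_add h n m : exp_prod h (n + m) =
  mulNC (exp_prod (fun i => h (n + i)%N) m) (exp_prod h n).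
Proof.
by elim: m => [|m IH]; rewrite ?addn0 ?mul1NC // addnS /= IH mulNCA.
Qed.

Lemma exp_prod_mul h c n m :
  exists e l, mulNC (exp_prod h n) (exp_prod c m) = exp_prod e l.
Proof.
exists (fun i => if (i < m)%N then c i else h (i - m)%N), (m + n)%N.
rewrite exp_prod_add; congr mulNC; apply: exp_prod_eq => i.
  by move=> _; rewrite [(_ < m)%N]ltnNge leq_addr /= addKn.
by move=> ->.
Qed.

Lemma exp_prod_inv h n : exists e l, mulNC (exp_prod h n) (exp_prod e l) = oneA R.
Proof.
elim: n => [|n [e [l IH]]]; first by exists h, 0%N; rewrite mul1NC.
have [e' [l' E']] := exp_prod_mul e (fun _ j => - h n j) l 1.
exists e', l'; rewrite -E' /= mulNC1 mulNCA -[mulNC (mulNC _ _) (exp_prod e l)]mulNCA.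
by rewrite IH mulNC1 expA_linANr.
Qed.

Lemma PLP f : PL R f <-> exists h n, f = exp_prod h n.
Proof.
split; last first.
  move=> [h [n ->]]; have [_ PL1 PLM _] := is_subgroup_PL.
  by elim: n => //= n IH; apply: PLM IH; exact: PL_exp.
move: f; apply: gen_subgroup_min => [|_ [_ [d _ <-] <-]]; last first.
  by exists (fun=> d), 1%N; rewrite /= mulNC1.
split.
- by move=> _ [h [n ->]]; exact: exp_prod_nil.
- by exists (fun _ _ => 0), 0%N.
- move=> _ _ [h [n ->]] [c [m ->]]; exact: exp_prod_mul.
- move=> _ g [h [n ->]] fg gf; have [e [l E]] := exp_prod_inv h n.
  by exists e, l; rewrite -[g]mulNC1 -E mulNCA gf mul1NC.
Qed.

(** Each factor e^h is the p-th power of e^(h/p). *)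
Lemma exp_prod_subdivide c n p : (0 < p)%N ->
  exp_prod (fun i j => p%:R^-1 * c (i %/ p)%N j) (n * p) = exp_prod c n.
Proof.
move=> p0; have pn0 : p%:R != 0 :> C by rewrite pnatr_eq0 -lt0n.
elim: n => // n IH; rewrite mulSnr exp_prod_add IH /=; congr mulNC.
have E q : (q <= p)%N ->
    exp_prod (fun i j => p%:R^-1 * c ((n * p + i) %/ p)%N j) q =
    expA (linA (fun j => q%:R / p%:R * c n j)).
  elim: q => [|q IHq] qp /=.
    by rewrite expA_linA0 // => j; rewrite !mul0r.
  rewrite IHq ?(ltnW qp) // divnMDl // divn_small // addn0 expA_linA_mul.
  by congr (expA (linA _)); apply/funext => j; rewrite -natr1; congr (_ * _); field.
by rewrite E // divff //; congr (expA (linA _)); apply/funext => j; rewrite mul1r.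
Qed.

Lemma exp_prod_local h c n (w : word) : (forall i j, j \in w -> h i j = c i j) ->
  exp_prod h n w = exp_prod c n w.
Proof.
elim: n w => //= n IH w hc; rewrite /mulNC; apply: eq_bigr => k _; congr (_ * _).
  rewrite !expA_linA /wprod big_seq [in RHS]big_seq; congr (_ / _).
  by apply: eq_bigr => j /mem_take /hc ->.
by apply: IH => i j /mem_drop /hc.
Qed.

(** A coefficient involves only the letters of its word. Truncation is needed because the
    coefficients of elements of L may grow arbitrarily fast, while [pathX] bounds the growth of its
    components. *)
Lemma exp_prod_truncate_cvg c n :
  (fun M => exp_prod (fun i j => if (j < M)%N then c i j else 0) n) @ \oo -->
  exp_prod c n.
Proof.
apply: ptws_cvgP => w.
apply: (@cvg_near_cst _ _ (exp_prod c n w)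
  (fun M => exp_prod (fun i j => if (j < M)%N then c i j else 0) n w)).
exists (weight w) => //= M wM; apply: exp_prod_local => i j jw.
have : (j < weight w)%N.
  elim: w jw {wM} => // l w IH; rewrite in_cons weight_cons => /orP[/eqP ->|/IH]; lia.
by move/leq_trans => ->.
Qed.

End Subgroups.

(** * Formal paths as the closure of the piecewise linear ones *)

Section Density.
Variable R : realType.
Notation C := (cplx R).
Notation N := (@ComplexField.Normc.normc R).
Notation Re := (@complex.Re R).
Notation Im := (@complex.Im R).
Variables (T : R) (T0 : 0 < T).
Implicit Types (a : nat -> R -> C) (x y s : R) (c : nat -> nat -> C).

Lemma bounded_measurable_itv x y :
  bounded_measurable T (fun s => ((x < s) && (s <= y))%:R : C).
Proof.
have E s : ((x < s) && (s <= y))%:R = \1_(`]x, y] : set R) s :> R.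
  by rewrite indicE; congr (nat_of_bool _)%:R; rewrite mem_setE in_itv.
split.
- rewrite (_ : _ \o _ = \1_(`]x, y] : set R)); first exact: measurable_indic.
  by apply/funext => s; rewrite /= -E; case: (_ && _).
- rewrite (_ : _ \o _ = cst 0); first exact: measurable_cst.
  by apply/funext => s /=; case: (_ && _).
- by exists 1 => s _; rewrite cplx_normc_nat lern1 leq_b1.
Qed.

Lemma bounded_measurable_sum (I : Type) (r : seq I) (F : I -> R -> C) :
  (forall i, bounded_measurable T (F i)) ->
  bounded_measurable T (fun s => \sum_(i <- r) F i s).
Proof.
move=> FT; elim: r => [|i r IH].
  by under eq_fun do rewrite big_nil; exact: bounded_measurable_cst.
by under eq_fun do rewrite big_cons; exact: bounded_measurableD.
Qed.

(* The factor n / T makes the integral over the l-th subinterval equal to c l. *)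
Definition step_path c n (j : nat) (s : R) : C :=
  \sum_(l < n) (n%:R / T)%:C%C * c l j *
    ((T * l%:R / n%:R < s) && (s <= T * l.+1%:R / n%:R))%:R.

Lemma step_path_bounded_measurable c n j : bounded_measurable T (step_path c n j).
Proof.
apply: bounded_measurable_sum => l; apply: bounded_measurableM.
  exact: bounded_measurable_cst.
exact: bounded_measurable_itv.
Qed.

(** With finitely many nonzero components one bound serves all, since a root of z is at most the
    larger of z and 1. *)
Lemma step_pathX c n M : (forall l j, (M <= j)%N -> c l j = 0) ->
  pathX T (step_path c n).
Proof.
move=> cM; split.
  by move=> j; have [mR mI _] := step_path_bounded_measurable c n j.
pose A j := \sum_(l < n) N ((n%:R / T)%:C%C * c l j).
have A0 j : 0 <= A j by apply: sumr_ge0 => l _; exact: cplx_normc_ge0.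
have jA j s : N (step_path c n j s) <= A j.
  apply: le_trans (cplx_normc_sum _ _ _) _; apply: ler_sum => l _.
  by rewrite cplx_normcM cplx_normc_nat ler_piMr ?cplx_normc_ge0 // lern1 leq_b1.
exists (1 + \sum_(j < M) A j) => j s _.
set z := N _; have z0 : 0 <= z by exact: cplx_normc_ge0.
have zA : z <= \sum_(j < M) A j.
  have [jM|Mj] := ltnP j M.
    apply: le_trans (jA j s) _; rewrite (bigD1 (Ordinal jM)) //= lerDl.
    by apply: sumr_ge0.
  rewrite /z /step_path big1; first by rewrite cplx_normc0 sumr_ge0.
  by move=> l _; rewrite cM // mulr0 mul0r.
have p0 : 0 <= j.+1%:R^-1 :> R by rewrite invr_ge0.
have p1 : j.+1%:R^-1 <= 1 :> R by rewrite invf_le1 // ler1n.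
have [z1|z1] := leP z 1.
  apply: le_trans (_ : 1 <= _); last by rewrite lerDl sumr_ge0.
  have le1 : z `^ j.+1%:R^-1 <= 1 `^ j.+1%:R^-1.
    by apply: (ge0_ler_powR p0) => //; rewrite nnegrE.
  by apply: le_trans le1 _; rewrite powR1.
by rewrite (le_trans (ler1_powR (ltW z1) p1)) // (le_trans zA) // lerDr.
Qed.

Lemma step_path_value c n p i j s : (0 < n)%N -> (0 < p)%N -> (i < n * p)%N ->
  T * i%:R / (n * p)%:R < s -> s <= T * i.+1%:R / (n * p)%:R ->
  step_path c n j s = (n%:R / T)%:C%C * c (i %/ p)%N j.
Proof.
move=> n0 p0 inp xs sy; pose l := (i %/ p)%N.
have ln : (l < n)%N by rewrite ltn_divLR.
have n0' : 0 < n%:R :> R by rewrite ltr0n.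
have p0' : 0 < p%:R :> R by rewrite ltr0n.
have node m : T * m%:R / n%:R = T * (m * p)%:R / (n * p)%:R.
  by rewrite !natrM; field; rewrite !lt0r_neq0.
have mono m m' : (m <= m')%N -> T * m%:R / (n * p)%:R <= T * m'%:R / (n * p)%:R.
  by move=> mm; rewrite ler_pM2r ?invr_gt0 ?ltr0n ?muln_gt0 ?n0 // ler_pM2l // ler_nat.
have li : (l * p <= i)%N by rewrite leq_trunc_div.
have il : (i < l.+1 * p)%N by rewrite ltn_ceil.
rewrite /step_path (bigD1 (Ordinal ln)) //= big1 => [|l' ll'].
  rewrite !node (le_lt_trans (mono _ _ li) xs) (le_trans sy (mono _ _ il)).
  by rewrite mulr1 addr0.
have [ll|ll] : (l' < l)%N \/ (l < l')%N.
  by move: ll'; rewrite -val_eqE /= -/l; case: ltngtP => // ? _; [left|right].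
- rewrite [X in _ && X]negbTE ?andbF ?mulr0 // -ltNge; apply: le_lt_trans xs.
  rewrite node; apply: mono; apply: leq_trans li.
  by rewrite leq_mul2r ll orbT.
- rewrite [X in X && _]negbTE ?mulr0 // -leNgt; apply: le_trans sy _.
  rewrite node; apply: mono; apply: leq_trans il _.
  by rewrite leq_mul2r ll orbT.
Qed.

Lemma increments_step_path c n p i : (0 < n)%N -> (0 < p)%N -> (i < n * p)%N ->
  increments T (step_path c n) (n * p) i = fun j => p%:R^-1 * c (i %/ p)%N j.
Proof.
move=> n0 p0 inp; apply/funext => j; rewrite /increments.
set x := T * i%:R / _; set y := T * i.+1%:R / _.
have n0' : 0 < n%:R :> R by rewrite ltr0n.
have p0' : 0 < p%:R :> R by rewrite ltr0n.
have np0 : 0 < (n * p)%:R :> R by rewrite ltr0n muln_gt0 n0.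
have x0 : 0 <= x by rewrite !mulr_ge0 // ltW // ?invr_gt0.
have xyE : y - x = T / (n * p)%:R by rewrite /x /y -natr1; ring.
have xy : x <= y by rewrite -subr_ge0 xyE mulr_ge0 ?invr_ge0 // ltW.
have yT : y <= T.
  by rewrite /y -mulrA ler_piMr ?(ltW T0) // ler_pdivrMr // mul1r ler_nat.
set z := (n%:R / T)%:C%C * c (i %/ p)%N j.
have sT := step_path_bounded_measurable c n j.
have zT : bounded_measurable T (fun=> - z) by exact: bounded_measurable_cst.
(* The path minus its value [z] on this cell vanishes there, so the bound 0 applies and the
   increment is that of a constant. *)
have := @cintegral_increment _ T _ x y 0 (bounded_measurableD sT zT) x0 xy yT.
rewrite mulr0 mul0r => H.
have {}H : N (cintegral (fun s => step_path c n j s - z) y -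
              cintegral (fun s => step_path c n j s - z) x) <= 0.
  apply: H => s xs sy.
  by rewrite (step_path_value _ _ _ _ inp xs sy) // subrr cplx_normc0.
have /ComplexField.Normc.eq0_normc : N (cintegral (fun s => step_path c n j s - z) y -
              cintegral (fun s => step_path c n j s - z) x) = 0.
  by apply/eqP; rewrite eq_le H cplx_normc_ge0.
rewrite !(cintegralD sT zT) ?(le_trans xy) // !cintegral_cst ?(le_trans x0) //.
move=> E.
have -> : cintegral (step_path c n j) y - cintegral (step_path c n j) x =
    z * (y - x)%:C%C.
  apply/eqP; rewrite -subr_eq0; apply/eqP; rewrite -[RHS]E rmorphB /=; ring.
rewrite xyE /z mulrAC -rmorphM /=.
have -> : n%:R / T * (T / (n * p)%:R) = p%:R^-1.
  by rewrite natrM; field; rewrite !lt0r_neq0.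
by rewrite fmorphV rmorph_nat.
Qed.

(** On grids with n (m + 1) cells the Euler products do not depend on m, so they equal their
    limit. *)
Lemma pathE_step_path c n M : (0 < n)%N -> (forall l j, (M <= j)%N -> c l j = 0) ->
  pathE T (step_path c n) = exp_prod c n.
Proof.
move=> n0 cM; apply/funext => w.
have [K HK] := euler_limit w (ltW T0) (step_pathX n cM).
apply/esym; apply: (@cplx_eq_from_bound _ _ _ `|K|) => m.
have := HK (n * m.+1)%N; rewrite muln_gt0 n0 => /(_ isT).
rewrite (@exp_prod_eq _ _ (fun i j => m.+1%:R^-1 * c (i %/ m.+1)%N j)); last first.
  by move=> i inm; rewrite increments_step_path.
rewrite exp_prod_subdivide // => le; apply: le_trans le _.
have n1 : 1 <= n%:R :> R by rewrite ler1n.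
apply: le_trans (_ : `|K| / (n * m.+1)%:R <= _).
  by rewrite ler_wpM2r ?invr_ge0 // ler_norm.
rewrite ler_wpM2l // lef_pV2 ?posrE ?ltr0n ?muln_gt0 ?n0 //.
by rewrite ler_nat leq_pmull.
Qed.

Lemma PL_sub_closure_paths : PL R `<=` closure (pathE T @` pathX T).
Proof.
have main (c : nat -> nat -> C) n : (0 < n)%N ->
    closure (pathE T @` pathX T) (exp_prod c n).
  move=> n0; apply: (closure_cvg _ (@exp_prod_truncate_cvg R c n)) => M.
  have cM : forall l j, (M <= j)%N -> (if (j < M)%N then c l j else 0) = 0.
    by move=> l j; rewrite ltnNge => ->.
  by exists (step_path (fun i j => if (j < M)%N then c i j else 0) n);
    [exact: step_pathX cM|exact: pathE_step_path cM].
move=> _ /PLP[h [[|n] ->]]; last exact: main.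
(* The empty product gets one trivial factor, as step paths need n > 0. *)
have -> : exp_prod h 0 = exp_prod (fun _ _ => 0) 1.
  by rewrite /= mulNC1 expA_linA0.
exact: main.
Qed.

Lemma pathE_closure_PL a : pathX T a -> closure (PL R) (pathE T a).
Proof.
move=> aX.
apply: (@closure_cvg _ _ (fun m => exp_prod (increments T a m.+1) m.+1)).
  by move=> m; apply/PLP; do 2 eexists.
apply: ptws_cvgP => w; have [K HK] := euler_limit w (ltW T0) aX.
by apply: (@cplx_cvg _ _ _ K) => m; exact: HK.
Qed.

Lemma closure_groupG (A : set (ncseries R)) : A `<=` groupG (R := R) ->
  closure A `<=` groupG (R := R).
Proof.
move=> AG f Af; apply: (@eq_on_closureT _ _ A (fun g : ncseries R => g [::]) (fun=> 1)
  (@cplx_hausdorff R)) => //.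
- exact: ptws_eval_continuous.
- exact: cplx_cst_continuous.
- by move=> g; rewrite inE => /AG.
Qed.

Lemma formal_pathsE : formal_paths T = closure (PL R).
Proof.
apply/seteqP; split=> [f [Ef _]|f Pf].
  have /closure_subset sub : pathE T @` pathX T `<=` closure (PL R).
    by move=> _ [a aX <-]; exact: pathE_closure_PL.
  by move/sub: Ef; rewrite -(closure_id _).1 //; exact: closed_closure.
have PG : PL R `<=` groupG (R := R) by case: (is_subgroup_PL R).
split; last exact: closure_groupG PG f Pf.
have sub := closure_subset PL_sub_closure_paths.
by move/sub: Pf; rewrite -(closure_id _).1 //; exact: closed_closure.
Qed.

Lemma PL_formal_paths : PL R `<=` formal_paths T.
Proof. by rewrite formal_pathsE; exact: subset_closure. Qed.

(** Both sides are continuous and agree on paths, which are dense. The reversal reflects that the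
    leftmost letter of a coefficient is integrated last. *)
Lemma IhatE (w : word) g : formal_paths T g -> Ihat T w g = g (rev w).
Proof.
have is_eval : is_Ihat T w (fun f : ncseries R => f (rev w)).
  split; first by apply: continuous_subspaceT; exact: ptws_eval_continuous.
  by move=> a aX; rewrite pathEE ?(ltW T0).
have [cI IE] : is_Ihat T w (Ihat T w).
  by apply: getPex; exists (fun f : ncseries R => f (rev w)).
move=> Fg; have [Eg _] := Fg.
apply: (@eq_on_closure _ _ (formal_paths T) (pathE T @` pathX T) (Ihat T w)
  (fun f : ncseries R => f (rev w)) (@cplx_hausdorff R) cI (proj1 is_eval)
  _ _ g Fg Eg).
- move=> _ [a aX <-]; rewrite formal_pathsE; exact: pathE_closure_PL.
- by move=> _ /set_mem[a aX <-]; rewrite IE // pathEE ?(ltW T0).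
Qed.

End Density.

(** * First return maps and centers *)

Lemma pair_continuous (X Y Z : topologicalType) (f : X -> Y) (g : X -> Z) :
  continuous f -> continuous g -> continuous (fun x => (f x, g x)).
Proof. by move=> cf cg x; exact: (cvg_pair (cf x) (cg x)). Qed.

Section FirstReturn.
Variable R : realType.
Notation C := (cplx R).
Variables (T : R) (T0 : 0 < T).
Implicit Types (f g : ncseries R) (s u : fpseries R) (w : word) (c : nat -> C).

Lemma PL_substitution_like : PL R `<=` @substitution_like R.
Proof.
move=> _ /PLP[h [n ->]]; elim: n => [|n IH] /=.
  by split=> // u v; rewrite !Theta1.
exact/substitution_like_mul/IH/substitution_like_exp.
Qed.

Lemma formal_paths_substitution_like : formal_paths T `<=` @substitution_like R.
Proof.
rewrite (formal_pathsE T0); apply: substitution_like_closure.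
exact: PL_substitution_like.
Qed.

Lemma pcoef_rcons w j (t : C) : pcoef (rcons w j) t =
  pcoef w t * (t - (weight w + j.+1)%:R + 1).
Proof.
rewrite /pcoef size_rcons big_ord_recr /=; congr (_ * _).
  apply: eq_bigr => i _; rewrite -cats1 takel_cat //.
rewrite take_oversize ?size_rcons // /weight -cats1 big_cat /= big_seq1.
by [].
Qed.

(** The factors on the left are, in reverse order, the exponents met when the letters of [w] act
    successively on r^(p+1). *)
Lemma pcoef_rev w p : pcoef (rev w) (p + weight w)%:R = (qcoef w p.+1)%:R :> C.
Proof.
elim: w p => [|j w IH] p; first by rewrite /pcoef big_ord0.
rewrite rev_cons pcoef_rcons weight_rev weight_cons addnA IH natrM mulrC.
by congr (_ * _); rewrite !natrD -natr1; ring.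
Qed.

(** Reversal permutes the words of a given weight; it undoes the one in [IhatE] and turns [pcoef]
    into [qcoef]. *)
Lemma PhatE g : formal_paths T g -> Phat T g = first_return g.
Proof.
move=> Fg; apply/funext => -[|[|i]]; rewrite first_returnE //=.
  by rewrite mu0; have [] := Fg.
rewrite -set_words -(fsbig_seq _ _ (uniq_words _)).
have revw : perm_eq [seq rev w | w <- words i.+1] (words i.+1).
  apply: uniq_perm; rewrite ?uniq_words ?map_inj_uniq ?uniq_words //.
    exact: (can_inj revK).
  move=> w; rewrite mem_words -[w in LHS]revK mem_map; last exact: (can_inj revK).
  by rewrite mem_words weight_rev.
rewrite -(perm_big _ revw) big_map /mu big_seq [RHS]big_seq; apply: eq_bigr => w.
rewrite mem_words => /eqP wi; rewrite (IhatE T0) // revK mulrC; congr (_ * _).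
by rewrite -(pcoef_rev w 0) add0n wi.
Qed.

Lemma first_return_oneA : first_return (oneA R) = idGr R.
Proof. exact: Theta1. Qed.

Lemma substitution_like_oneA : substitution_like (oneA R).
Proof. by split=> // u v; rewrite !Theta1. Qed.

Lemma compP_idGr u : compP u (idGr R) = u.
Proof.
by rewrite -first_return_oneA -Theta_compP ?Theta1 //; exact: substitution_like_oneA.
Qed.

(* The section of the first return map with values in e^L (it equals T_PL, see TPLE),
   and its inverse in the group. *)
Definition exp_of s : ncseries R := expA (linA (log_coords s)).
Definition exp_inv_of s : ncseries R := expA (linA (fun j => - log_coords s j)).

Lemma exp_of_continuous : continuous exp_of.
Proof.
rewrite (_ : exp_of = fun s => expA (linA (fun j => 1 * log_coords s j))).
  exact: exp_log_coords_continuous.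
by apply/funext => s; congr (expA (linA _)); apply/funext => j; rewrite mul1r.
Qed.

Lemma exp_inv_of_continuous : continuous exp_inv_of.
Proof.
rewrite (_ : exp_inv_of = fun s => expA (linA (fun j => -1 * log_coords s j))).
  exact: exp_log_coords_continuous.
by apply/funext => s; congr (expA (linA _)); apply/funext => j; rewrite mulN1r.
Qed.

Lemma PL_exp_of s : PL R (exp_of s). Proof. exact: PL_exp. Qed.
Lemma PL_exp_inv_of s : PL R (exp_inv_of s). Proof. exact: PL_exp. Qed.

Lemma exp_ofK s f : mulNC (exp_inv_of s) (mulNC (exp_of s) f) = f.
Proof. by rewrite mulNCA expA_linAN mul1NC. Qed.

Lemma exp_ofVK s f : mulNC (exp_of s) (mulNC (exp_inv_of s) f) = f.
Proof. by rewrite mulNCA expA_linANr mul1NC. Qed.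

Lemma first_return_retraction g : substitution_like g ->
  first_return (mulNC (exp_inv_of (first_return g)) g) = idGr R.
Proof.
move=> gS; rewrite first_return_mulNC //; set s := first_return g.
have sG : groupGr R s by apply: first_return_groupGr; case: gS.
rewrite -{2}[s](first_return_log_coords sG) -first_return_mulNC.
  by rewrite expA_linAN first_return_oneA.
exact: substitution_like_exp.
Qed.

Lemma exp_inv_of_idGr : exp_inv_of (idGr R) = oneA R.
Proof.
rewrite -[LHS]mulNC1 -[in LHS](@expA_linA0 R (log_coords (idGr R))).
  exact: expA_linAN.
suff -> : log_coords (idGr R) = (fun=> 0) by [].
apply: first_return_exp_inj; rewrite first_return_log_coords //.
by rewrite expA_linA0 // first_return_oneA.
Qed.

(** An explicit [Phi]: on the constant sequence 1, at index 0, [psi g m] gives [mu g m 1], the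
    coefficient of r^(m+1) in the first return map. *)
Definition eval_Phi (F : opseries R) : fpseries R :=
  fun n => if n is m.+1 then F m (fun=> 1) 0%N else 0.

Lemma eval_Phi_psi g : eval_Phi (psi g) = first_return g.
Proof. by apply/funext => -[|n]; rewrite first_returnE //= /psi mulr1. Qed.

Lemma eval_Phi_continuous : continuous eval_Phi.
Proof.
apply: ptws_continuousP => -[|m]; first exact: (@cplx_cst_continuous R (opseries R) 0).
move=> F; apply: (@continuous_comp _ _ _ (fun F : opseries R => F m)
  (fun F : oper R => F (fun=> 1) 0%N)); first exact: ptws_eval_continuous.
apply: (@continuous_comp _ _ _ (fun F : oper R => F (fun=> 1))
  (fun F : fpseries R => F 0%N)); exact: ptws_eval_continuous.
Qed.

Lemma formal_paths_exp_of s : formal_paths T (exp_of s).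
Proof. exact: (PL_formal_paths T0 (PL_exp_of s)). Qed.

Lemma psi_exp_of g : substitution_like g -> psi (exp_of (first_return g)) = psi g.
Proof.
move=> gS; apply: eq_psi => n k; apply: first_return_inj => //.
  exact: substitution_like_exp.
by apply: first_return_log_coords; apply: first_return_groupGr; case: gS.
Qed.

(** The inverse is [psi] after [exp_of], by [psi_exp_of]. *)
Lemma is_Phi_eval : is_Phi T eval_Phi.
Proof.
have S g : formal_paths T g -> substitution_like g.
  exact: formal_paths_substitution_like.
have inv : {in groupS T, cancel eval_Phi (fun s => psi (exp_of s))}.
  move=> _ /set_mem[g Fg <-]; rewrite PsiE eval_Phi_psi psi_exp_of //; exact: S.
split.
- split.
  + split.
    * move=> _ [g Fg <-]; rewrite PsiE eval_Phi_psi.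
      by apply: first_return_groupGr; case: (S g Fg).
    * by move=> x y xS yS E; rewrite -(inv x xS) E (inv y yS).
    * move=> s sG; exists (psi (exp_of s)).
        by exists (exp_of s); [exact: formal_paths_exp_of|rewrite PsiE].
      by rewrite eval_Phi_psi first_return_log_coords.
  + by apply: continuous_subspaceT; exact: eval_Phi_continuous.
  + exists (fun s => psi (exp_of s)) => //.
    apply: continuous_subspaceT => s.
    apply: (@continuous_comp _ _ _ exp_of (@psi R)); first exact: exp_of_continuous.
    exact: psi_continuous.
- move=> _ _ /set_mem[f Ff <-] /set_mem[g Fg <-].
  rewrite PsiE -psi_mulNC !eval_Phi_psi first_return_mulNC //; exact: S.
- by move=> g /set_mem Fg; rewrite PsiE eval_Phi_psi PhatE.
Qed.

Lemma is_Phi_Phi : is_Phi T (Phi T).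
Proof. by apply: getPex; exists eval_Phi; exact: is_Phi_eval. Qed.

Lemma PhiE g : formal_paths T g -> Phi T (psi g) = first_return g.
Proof.
move=> Fg; have [_ _ H] := is_Phi_Phi.
by rewrite -PsiE -H ?inE // PhatE.
Qed.

Lemma lieLie_linA c : lieLie (linA c).
Proof.
split=> // -[|n] // _.
have -> : homogA n.+1 (linA c) = c n *: genA R n.
  apply/funext => w; rewrite /homogA ncseriesZ /genA.
  case: w => [|j [|k w]] /=; first by rewrite weight_nil mulr0.
    rewrite weight_cons weight_nil addn0 eqSS eqseq_cons andbT.
    by case: eqVneq => [->|]; rewrite ?mulr1 ?mulr0.
  by rewrite eqseq_cons andbF mulr0; case: ifP.
by apply: free_lieZ; exact: free_lie_gen.
Qed.

Lemma mapA_linS c : mapA (linS c) = linA c.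
Proof.
rewrite /mapA; congr linA; apply: linS_inj; apply/esym.
exact: (@getPex _ [set c' : nat -> C | linS c = linS c'] (ex_intro _ c erefl)).
Qed.

(** The preimage of [s] under [Phi] is the exponential of [linS (log_coords s)]. The two partial
    inverses can be evaluated because [Phi] is injective on [groupS T] and [expS] on [lieS]. *)
Lemma TPLE s : groupGr R s -> TPL T s = exp_of s.
Proof.
move=> sG; have [[[_ injPhi _] _ _] _ _] := is_Phi_Phi.
rewrite /TPL.
have -> : 'pinv_(fun=> 0) (groupS T) (Phi T) s = psi (exp_of s).
  rewrite -[in LHS](first_return_log_coords sG) -PhiE; last exact: formal_paths_exp_of.
  have mem : psi (expA (linA (log_coords s))) \in groupS T.
    by rewrite inE; exists (exp_of s); [exact: formal_paths_exp_of|rewrite PsiE].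
  by rewrite (pinvKV _ injPhi mem).
rewrite /logS psi_expA // pinvKV ?psi_linA ?mapA_linS //.
  move=> _ _ /set_mem[f [f0 _] <-] /set_mem[g [g0 _] <-]; rewrite PsiE.
  exact: expS_psi_inj.
rewrite inE; exists (linA (log_coords s)); first exact: lieLie_linA.
by rewrite PsiE psi_linA.
Qed.

(* No Campbell-Hausdorff formula is needed: e^a e^b and the exponential on the right
   have the same first return map, and expS is injective on the image of lieG. *)
Lemma sLE c c' (g := mulNC (expA (linA c)) (expA (linA c'))) :
  sL (linA c) (linA c') = linA (log_coords (first_return g)).
Proof.
have gS : substitution_like g by apply: substitution_like_mul; exact: substitution_like_exp.
have [f0 fE] : logA g [::] = 0 /\ expA (logA g) = g by apply: logAK; case: gS.
rewrite /sL -/g PsiE -mapA_linS -psi_linA; congr mapA; apply: expS_psi_inj => //.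
by rewrite -!psi_expA // fE -/(exp_of _) psi_exp_of.
Qed.

(** * Piecewise linear centers *)

Lemma centersPLE g : centersPL T g <-> PL R g /\ first_return g = idGr R.
Proof.
split=> [[[Fg Pg] PLg]|[PLg gid]]; first by rewrite -PhatE.
have Fg := PL_formal_paths T0 PLg.
by split=> //; split=> //; rewrite PhatE.
Qed.

Lemma is_subgroup_centersPL : is_subgroup (centersPL T).
Proof.
have [PG P1 PM PV] := is_subgroup_PL R.
split.
- by move=> g /centersPLE[/PG].
- by apply/centersPLE; rewrite first_return_oneA.
- move=> f g /centersPLE[Pf f1] /centersPLE[Pg g1]; apply/centersPLE.
  split; first exact: PM.
  by rewrite first_return_mulNC ?f1 ?g1 ?compP_idGr //; exact: PL_substitution_like.
- move=> f g /centersPLE[Pf f1] fg gf; apply/centersPLE.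
  split; first exact: PV fg gf.
  rewrite -first_return_oneA -gf first_return_mulNC ?f1 ?compP_idGr //.
  exact: PL_substitution_like.
Qed.

Definition retraction g : ncseries R := mulNC (exp_inv_of (first_return g)) g.

Lemma retraction_continuous : continuous retraction.
Proof.
apply: mulNC_continuous; last by move=> g; exact: cvg_id.
move=> g; apply: (@continuous_comp _ _ _ (@first_return R) exp_inv_of).
  exact: first_return_continuous.
exact: exp_inv_of_continuous.
Qed.

Lemma centersPL_retraction g : PL R g -> centersPL T (retraction g).
Proof.
move=> Pg; apply/centersPLE; split; last first.
  exact/first_return_retraction/PL_substitution_like.
by have [_ _ PM _] := is_subgroup_PL R; apply: PM => //; exact: PL_exp_inv_of.
Qed.

(** The inverse pairs [first_return] with [retraction], both continuous on all of [ncseries]. *)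
Lemma PL_homeo : homeo_on (groupGr R `*` centersPL T) (PL R)
  (fun sg : fpseries R * ncseries R => mulNC (TPL T sg.1) sg.2).
Proof.
have [_ _ PM _] := is_subgroup_PL R.
have ret s g : groupGr R s -> centersPL T g ->
    first_return (mulNC (exp_of s) g) = s.
  move=> sG /centersPLE[Pg g1].
  rewrite first_return_mulNC ?g1 ?compP_idGr ?first_return_log_coords //.
  exact: PL_substitution_like.
have inv : {in groupGr R `*` centersPL T,
    cancel (fun sg : fpseries R * ncseries R => mulNC (TPL T sg.1) sg.2)
           (fun p => (first_return p, retraction p))}.
  move=> [s g] /set_mem[/= sG Cg]; rewrite TPLE // ret //; congr pair.
  by rewrite /retraction ret // exp_ofK.
split.
- split.
  + move=> [s g] [/= sG Cg]; rewrite TPLE //; apply: PM; first exact: PL_exp_of.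
    by case/centersPLE: Cg.
  + by move=> x y xS yS E; rewrite -(inv x xS) E (inv y yS).
  + move=> p Pp; have pS := PL_substitution_like Pp.
    have sG : groupGr R (first_return p) by apply: first_return_groupGr; case: pS.
    exists (first_return p, retraction p).
      by split=> //; exact: centersPL_retraction.
    by rewrite /= TPLE // exp_ofVK.
(* [TPL] is known only on [groupGr], where it agrees with the everywhere continuous [exp_of]. *)
- apply: (@subspace_eq_continuous _ _ _ (fun sg : fpseries R * ncseries R =>
    mulNC (exp_of sg.1) sg.2)).
    by move=> [s g] /set_mem[/= sG _]; rewrite /from_subspace /= TPLE.
  apply: continuous_subspaceT; apply: mulNC_continuous; last by move=> x; exact: cvg_snd.
  move=> x; apply: (@continuous_comp _ _ _ fst exp_of); first exact: cvg_fst.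
  exact: exp_of_continuous.
- exists (fun p => (first_return p, retraction p)) => //.
  apply: continuous_subspaceT.
  exact: (pair_continuous (@first_return_continuous R) retraction_continuous).
Qed.

Lemma centersPL_generators : centersPL T =
  gen_subgroup
    [set mulNC (mulNC (expA a) (expA b)) (expA (- sL a b)) | a in linL R & b in linL R].
Proof.
set B := [set _ | _ in _ & _ in _].
have [_ _ PM _] := is_subgroup_PL R.
have BE c c' (g := mulNC (expA (linA c)) (expA (linA c'))) :
    mulNC g (expA (- sL (linA c) (linA c'))) = mulNC g (exp_inv_of (first_return g)).
  by rewrite sLE -linAN.
have BC : B `<=` centersPL T.
  move=> _ [_ [c _ <-] [_ [c' _ <-] <-]]; rewrite BE; set g := mulNC _ (expA (linA c')).
  have Pg : PL R g by apply: PM; exact: PL_exp.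
  apply/centersPLE; split; first by apply: PM => //; exact: PL_exp_inv_of.
  set s := first_return g.
  have sG : groupGr R s.
    by apply: first_return_groupGr; case: (PL_substitution_like Pg).
  rewrite first_return_mulNC; last exact: substitution_like_exp.
  rewrite -/s -{1}(first_return_log_coords sG) -first_return_mulNC.
    by rewrite expA_linANr first_return_oneA.
  exact: substitution_like_exp.
apply/seteqP; split; last exact: gen_subgroup_min is_subgroup_centersPL BC.
have BG : B `<=` groupG (R := R).
  by have [CG _ _ _] := is_subgroup_centersPL; exact: subset_trans BC CG.
have [_ N1 NM _] := is_subgroup_gen BG.
move=> p /centersPLE[/PLP[h [n ph]] p1].
have [c [g [Ng pE]]] : exists c g, gen_subgroup B g /\ p = mulNC g (expA (linA c)).
  rewrite ph.
  (* The rightmost factor [d 0] is split off; next to it stands the trailing exponential of the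
     induction hypothesis, and the two merge into a generator times one exponential. *)
  have main m : forall d, exists c g, gen_subgroup B g /\
      exp_prod d m = mulNC g (expA (linA c)).
    elim: m => [|m IH] d.
      exists (fun=> 0), (oneA R); split=> //.
      by rewrite mul1NC expA_linA0.
    have [c [g [Ng E]]] := IH (fun i => d i.+1).
    pose e := mulNC (expA (linA c)) (expA (linA (d 0%N))).
    exists (log_coords (first_return e)).
    exists (mulNC g (mulNC e (exp_inv_of (first_return e)))).
    split.
      apply: NM => //; apply: gen_subgroup_sub; rewrite -BE.
      by exists (linA c); [exists c|exists (linA (d 0%N)); [exists (d 0%N)|]].
    rewrite -[m.+1]add1n exp_prod_add /= mulNC1 E -!mulNCA; congr mulNC.
    by rewrite expA_linAN mulNC1.
  exact: main.
(* As [p] and [g] are centers, the remaining exponential has the first return map of the identity,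
   which forces [c] to vanish. *)
suff c0 : expA (linA c) = oneA R by rewrite pE c0 mulNC1.
have /centersPLE[_ g1] : centersPL T g.
  exact: gen_subgroup_min is_subgroup_centersPL BC _ Ng.
apply/expA_linA0 => j; suff -> : c = (fun=> 0) by [].
have cS := substitution_like_exp c.
apply: first_return_exp_inj; rewrite (@expA_linA0 _ (fun=> 0)) // first_return_oneA.
have : first_return p = compP (idGr R) (first_return (expA (linA c))).
  by rewrite pE first_return_mulNC // g1.
by rewrite p1 -Theta_compP // => <-.
Qed.

(** The continuous [retraction] fixes [g] and sends piecewise linear elements close to [g] to
    centers close to [g]. *)
Lemma formal_centers_closure : formal_centers T `<=` closure (centersPL T).
Proof.
move=> g [Fg Pg] U Ug.
have g1 : first_return g = idGr R by rewrite -PhatE.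
have rg : retraction g = g by rewrite /retraction g1 exp_inv_of_idGr mul1NC.
have Ug' : nbhs g (retraction @^-1` U).
  by apply: retraction_continuous; rewrite rg.
have := Fg; rewrite (formal_pathsE T0) => /(_ _ Ug')[p [Pp Up]].
by exists (retraction p); split => //; exact: centersPL_retraction.
Qed.

End FirstReturn.

Theorem proposition3p14 (R : realType) (T : R) (T_gt0 : 0 < T) :
  [/\ homeo_on (groupGr R `*` centersPL T) (PL R)
        (fun sg : fpseries R * ncseries R => mulNC (TPL T sg.1) sg.2),
      centersPL T =
        gen_subgroup
          [set mulNC (mulNC (expA a) (expA b)) (expA (- sL a b))
             | a in linL R & b in linL R] &
      [/\ is_subgroup (centersPL T),
          centersPL T `<=` formal_centers T &
          formal_centers T `<=` closure (centersPL T)]].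
Proof.
split; [exact: PL_homeo|exact: centersPL_generators|split].
- exact: is_subgroup_centersPL.
- by move=> g [].
- exact: formal_centers_closure.
Qed.
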